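(* Suppose the diffeomorphism $u_{i+1}=f(u_i,s)$ of $\mathbb{R}^m$ is uniform-hyperbolic and has a global compact attractor. Then on every trajectory $\{u_l\}_{l=0}^\infty$ on the attractor there exists a unique adjoint shadowing direction $\{\overline{v}_l\}_{l=0}^\infty$. Further, the adjoint sensitivity formula holds: $$\frac{dJ_{avg}}{ds}=\lim_{N\to\infty}\frac1N\sum_{l=0}^{N-1}\left(\langle\overline{v}_{l+1},f_{sl}\rangle+J_{sl}\right).$$
   Context: Setting. $f(u,s)\in\mathbb{R}^m$ and $J(u,s)\in\mathbb{R}$ are smooth functions of $u\in\mathbb{R}^m$ and of the parameter $s\in\mathbb{R}$, and $f(\cdot,s)$ is a diffeomorphism. A trajectory satisfies $u_{i+1}=f(u_i,s)$. The objective is $J_{avg}:=\lim_{N\to\infty}\frac1N\sum_{i=0}^{N-1}J(u_i,s)$, which is assumed to depend only on $s$ and not on the initial condition. Notation: $f_{ul}:=\frac{\partial f}{\partial u}(u_l,s)$, $f_{sl}:=\frac{\partial f}{\partial s}(u_l,s)$, $J_{ul}:=\frac{\partial J}{\partial u}(u_l,s)$, $J_{sl}:=\frac{\partial J}{\partial s}(u_l,s)$. $\langle\cdot,\cdot\rangle$, $\|\cdot\|$ are the Euclidean inner product and norm, and $\cdot^T$ on matrices is the transpose. Tangent propagation operator. $D_l^i$ is the matrix mapping $w_l$ to $w_i$ for solutions of $w_{i+1}=f_{ui}w_i$: the identity if $i=l$, $f_{u,i-1}\cdots f_{u,l}$ if $i>l$, and $f_{u,i}^{-1}\cdots f_{u,l-1}^{-1}$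 if $i<l$. Uniform hyperbolicity. There are $C\in(0,\infty)$ and $\lambda>0$ such that for all $u$ on the attractor there is a splitting of the tangent space $\mathbb{R}^m=V^+(u)\oplus V^-(u)$ such that, on the trajectory passing $u$ at step $0$: (1) for $v\in V^+(u)$ and $i\le-1$, $\|D_0^iv\|\le Ce^{-\lambda|i|}\|v\|$; (2) for $v\in V^-(u)$ and $i\ge1$, $\|D_0^iv\|\le Ce^{-\lambda|i|}\|v\|$. Unstable adjoint subspace. Let $P^+_i$ be the projection onto $V^+(u_i)$ along $V^-(u_i)$, and $\overline{P}^+_i:=(P_i^+)^T$. The unstable adjoint subspace at step $i$ is the image of $\overline{P}^+_i$, and the component of $x$ in it is $\overline{P}_i^+x$. Adjoint shadowing direction. On a trajectory $\{u_l\}_{l=0}^\infty$ on the attractor, an adjoint shadowing direction is a sequence $\{\overline{v}_l\}_{l=0}^\infty$ in $\mathbb{R}^m$ such that: (1) $\overline{v}_l=f_{ul}^T\overline{v}_{l+1}+J_{ul}$ for all $l\ge0$; (2) $\overline{v}_0$ has zero component in the unstable adjoint subspace; (3) $\|\overline{v}_l\|$ is bounded by a constant for all $l\ge0$.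
   Formalization: The splitting into V^+(u) and V^-(u) is additionally required to be invariant under the derivative of f (standard for uniform hyperbolicity); with the two estimates alone the claim fails, e.g. on an orbit from a source to a sink in dimension one. *)

(* Defs.v *)
From HB Require Import structures.
From mathcomp Require Import all_boot all_order all_algebra.
From mathcomp Require Import all_classical all_reals all_analysis.

Set Implicit Arguments.
Unset Strict Implicit.
Unset Printing Implicit Defensive.

Import Order.TTheory GRing.Theory Num.Theory.
Import numFieldNormedType.Exports.

Local Open Scope classical_set_scope.
Local Open Scope ring_scope.

(* The library norm on matrices is the sup norm, so the Euclidean structure on
   'cV[R]_m is defined here; both norms induce the same topology. *)
Definition dot (R : realType) (m : nat) (x y : 'cV[R]_m) : R :=
  \sum_(i < m) x i 0 * y i 0.

Definition enorm (R : realType) (m : nat) (x : 'cV[R]_m) : R :=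
  Num.sqrt (dot x x).

(* On a finite-dimensional V this is the usual class C^k: x |-> 'd f x is C^k as
   a map into the linear maps iff x |-> 'd f x v is C^k for every v. *)
Fixpoint Ck (R : realType) (V W : normedModType R) (k : nat) (f : V -> W)
    : Prop :=
  match k with
  | 0%N => continuous f
  | k'.+1 => (forall x, differentiable f x) /\
             (forall v : V, Ck k' (fun x => 'd f x v))
  end.

Definition smooth (R : realType) (V W : normedModType R) (f : V -> W) : Prop :=
  forall k, Ck k f.

Definition diffeomorphism (R : realType) (V W : normedModType R) (f : V -> W)
    : Prop :=
  smooth f /\ exists g : W -> V, [/\ cancel f g, cancel g f & smooth g].

Section Dynamics.
Variables (R : realType) (m : nat).
Variables (f : 'cV[R]_m -> R -> 'cV[R]_m) (J : 'cV[R]_m -> R -> R).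

(* Column convention: f_u i j is the partial derivative of f_i along u_j (the
   library's 'J is the transpose, acting on row vectors). *)
Definition f_u (u : 'cV[R]_m) (s : R) : 'M[R]_m :=
  \matrix_(i, j) ('D_(delta_mx j 0) (fun x => f x s) u) i 0.

Definition f_s (u : 'cV[R]_m) (s : R) : 'cV[R]_m := derive1 (f u) s.

Definition J_u (u : 'cV[R]_m) (s : R) : 'cV[R]_m :=
  \col_j 'D_(delta_mx j 0) (fun x => J x s) u.

Definition J_s (u : 'cV[R]_m) (s : R) : R := derive1 (J u) s.

Definition trajectory (s : R) (u : nat -> 'cV[R]_m) : Prop :=
  forall i, u i.+1 = f (u i) s.

Definition full_trajectory (s : R) (u : int -> 'cV[R]_m) : Prop :=
  forall i : int, u (i + 1) = f (u i) s.

Definition is_Javg (Javg : R -> R) : Prop :=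
  forall (s : R) (u : nat -> 'cV[R]_m), trajectory s u ->
    (fun N : nat => (N%:R)^-1 * \sum_(i < N) J (u i) s) @ \oo --> Javg s.

(* prop_fwd s u l n = f_{u,l+n-1} ... f_{u,l} and
   prop_bwd s u l n = f_{u,l-n}^-1 ... f_{u,l-1}^-1. *)
Fixpoint prop_fwd (s : R) (u : int -> 'cV[R]_m) (l : int) (n : nat) : 'M[R]_m :=
  match n with
  | 0%N => 1%:M
  | n'.+1 => f_u (u (l + n'%:Z)) s *m prop_fwd s u l n'
  end.

Fixpoint prop_bwd (s : R) (u : int -> 'cV[R]_m) (l : int) (n : nat) : 'M[R]_m :=
  match n with
  | 0%N => 1%:M
  | n'.+1 => invmx (f_u (u (l - n'.+1%:Z)) s) *m prop_bwd s u l n'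
  end.

(* D_l^i *)
Definition tangent_prop (s : R) (u : int -> 'cV[R]_m) (l i : int) : 'M[R]_m :=
  if l <= i then prop_fwd s u l `|i - l|%N else prop_bwd s u l `|i - l|%N.

(* The word "attractor" only requires here that K attract every trajectory;
   stronger notions (attraction uniform on bounded sets) are particular cases. *)
Definition global_compact_attractor (s : R) (K : set 'cV[R]_m) : Prop :=
  [/\ compact K,
      (fun u => f u s) @` K = K &
      forall u, trajectory s u -> forall e : R, 0 < e ->
        \forall n \near \oo, exists2 a, K a & enorm (u n - a) < e].

(* Vp u and Vm u are the unstable and stable subspaces at u. The invariance
   clauses are part of the notion: uniform estimates alone also hold, for a
   large C, along a heteroclinic orbit from a source to a sink. *)
Definition hyperbolic_splitting (s : R) (K : set 'cV[R]_m)
    (Vp Vm : 'cV[R]_m -> {vspace 'cV[R]_m}) : Prop :=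
  exists C lam : R, [/\ 0 < C, 0 < lam &
    forall u : 'cV[R]_m, K u ->
    [/\ (Vp u + Vm u)%VS = fullv /\ (Vp u :&: Vm u)%VS = 0%VS,
        (forall v, (v \in Vp u) = (f_u u s *m v \in Vp (f u s))) /\
        (forall v, (v \in Vm u) = (f_u u s *m v \in Vm (f u s))) &
        forall w : int -> 'cV[R]_m, full_trajectory s w -> w 0 = u ->
          (forall v (i : int), v \in Vp u -> i <= -1 ->
             enorm (tangent_prop s w 0 i *m v)
               <= C * expR (- lam * (`|i|%N)%:R) * enorm v) /\
          (forall v (i : int), v \in Vm u -> 1 <= i ->
             enorm (tangent_prop s w 0 i *m v)
               <= C * expR (- lam * (`|i|%N)%:R) * enorm v)]].

(* Matrix of the projection onto V along W. *)
Definition proj_matrix (V W : {vspace 'cV[R]_m}) : 'M[R]_m :=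
  \matrix_(i, j) (daddv_pi V W (delta_mx j 0)) i 0.

Definition adjoint_shadowing (s : R) (Vp Vm : 'cV[R]_m -> {vspace 'cV[R]_m})
    (u vbar : nat -> 'cV[R]_m) : Prop :=
  [/\ forall l, vbar l = (f_u (u l) s)^T *m vbar l.+1 + J_u (u l) s,
      (proj_matrix (Vp (u 0%N)) (Vm (u 0%N)))^T *m vbar 0%N = 0 &
      exists M : R, forall l, enorm (vbar l) <= M].

End Dynamics.

(* Main.v *)
Require Import Defs.
From HB Require Import structures.
From mathcomp Require Import all_boot all_order all_algebra.
From mathcomp Require Import all_classical all_reals all_analysis.
From mathcomp Require Import ring lra zify.

(** The theorem reduces to linear recursions with an exponential dichotomy.

    Along the orbit [u] let [A l] be the derivative of the map in the state.
    Hyperbolicity gives [A] a dichotomy ([hyperbolic_dichotomy]): a projection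
    that commutes with the dynamics, forward decay on one side and backward
    decay on the other. The projections are bounded because the growth of
    unstable vectors keeps the two subspaces apart ([splitting_angle]). Under a
    dichotomy the inhomogeneous recursion has, for each bounded forcing, exactly
    one bounded solution without initial component in the decaying directions
    ([dichotomy_bounded_solution], [dichotomy_bounded_unique]): the decaying
    part is summed from the past and the growing part from the future.

    Transposing and inverting [A] gives another dichotomy
    ([dichotomy_adjoint]), whose decaying directions form the unstable adjoint
    subspace. The adjoint shadowing direction is the bounded solution for it,
    hence it exists and is unique.

    For the derivative, let [v] be a bounded solution of
    [v l.+1 = A l *m v l + f_s]. A Newton iteration with the linear part frozen
    along [u] corrects [u + d v] into a true orbit of the map with parameter
    [s + d], at distance [o(d)] uniformly in time ([shadowing_orbits]). As every
    orbit computes the average, [Javg (s + d) - Javg s] agrees up to [o(d)] with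
    [d] times the averages of [<J_u, v> + J_s], uniformly in the length of the
    average. This makes these averages converge, and their limit is the
    derivative ([derivable_of_averages]). Finally
    [<vbar l.+1, f_s> - <J_u, v l>] telescopes to a bounded boundary term
    ([adjoint_tangent_telescope]), so that the averages in the adjoint formula
    have the same limit. *)

Set Implicit Arguments.
Unset Strict Implicit.
Unset Printing Implicit Defensive.

Import Order.TTheory GRing.Theory Num.Theory.
Import numFieldNormedType.Exports.

Local Open Scope classical_set_scope.
Local Open Scope ring_scope.

(** * The sup norm of matrices and geometric limits *)

Lemma eq_ler (R : realType) (x y : R) : x = y -> x <= y.
Proof. by move=> ->. Qed.

Lemma normmx_entry (R : realType) (m n : nat) (M : 'M[R]_(m, n)) i j :
  `|M i j| <= `|M|.
Proof.
rewrite [leRHS]/Num.norm /= mx_normrE.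
by apply/bigmax_geP; right; exists (i, j).
Qed.

Lemma normmx_le (R : realType) (m n : nat) (M : 'M[R]_(m, n)) (c : R) :
  0 <= c -> (forall i j, `|M i j| <= c) -> `|M| <= c.
Proof.
move=> c0 Mc; rewrite [leLHS]/Num.norm /= mx_normrE.
by apply/bigmax_leP; split => // -[i j] _; exact: Mc.
Qed.

Lemma normmx_mul (R : realType) (m p n : nat)
  (M : 'M[R]_(m, p)) (N : 'M[R]_(p, n)) : `|M *m N| <= p%:R * `|M| * `|N|.
Proof.
apply: normmx_le => [|i j]; first by rewrite !mulr_ge0.
rewrite mxE; apply: le_trans (ler_norm_sum _ _ _) _.
rewrite -mulrA mulr_natl -[p in _ *+ p]card_ord -sumr_const.
by apply: ler_sum => k _; rewrite normrM ler_pM // normmx_entry.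
Qed.

Lemma normmx_tr (R : realType) (m n : nat) (M : 'M[R]_(m, n)) : `|M^T| = `|M|.
Proof.
apply/eqP; rewrite eq_le; apply/andP; split; apply: normmx_le => // i j.
  by rewrite mxE normmx_entry.
by rewrite -[M]trmxK mxE [in leRHS]trmxK normmx_entry.
Qed.

Lemma le0_geometric (R : realType) (a c t : R) : 0 <= t -> t < 1 ->
  (forall n : nat, a <= c * t ^+ n) -> a <= 0.
Proof.
move=> t0 t1 ac.
have c0 : geometric c t @ \oo --> (0 : R).
  by apply: cvg_geometric; rewrite ger0_norm.
rewrite leNgt; apply/negP => a0.
have /cvgrPdist_lt /(_ _ a0) [N _ /(_ N (leqnn N)) /=] := c0.
by rewrite sub0r normrN ltNge (le_trans (ac N)) ?ler_norm.
Qed.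

Lemma sum_geometric_le (R : realType) (t : R) (n : nat) : 0 <= t -> t < 1 ->
  \sum_(i < n) t ^+ i <= (1 - t)^-1.
Proof.
move=> t0 t1; have t1' : 0 < 1 - t by rewrite subr_gt0.
rewrite -(ler_pM2l t1') divff ?gt_eqF // -[1 - t]opprB mulNr -subrX1 opprB.
by rewrite gerBl exprn_ge0.
Qed.

(** The limit comes with the rate of convergence, so that identities between
    limits can be checked on the approximations by [le0_geometric]. *)
Lemma geometric_limit (R : realType) (m : nat) (x : nat -> 'cV[R]_m) (c t : R) :
  0 <= t -> t < 1 -> (forall n, `|x n.+1 - x n| <= c * t ^+ n) ->
  exists l, forall n, `|l - x n| <= c / (1 - t) * t ^+ n.
Proof.
move=> t0 t1 xc; have t1' : 0 < 1 - t by rewrite subr_gt0.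
have c0 : 0 <= c by have := le_trans (normr_ge0 _) (xc 0%N); rewrite mulr1.
have xk n k : `|x (n + k)%N - x n| <= c / (1 - t) * t ^+ n.
  have -> : x (n + k)%N - x n = \sum_(i < k) (x (n + i).+1 - x (n + i)%N).
    elim: k => [|k IH]; first by rewrite addn0 subrr big_ord0.
    by rewrite big_ord_recr -IH addnS /= addrC addrA subrK.
  apply: le_trans (ler_norm_sum _ _ _) _.
  apply: (@le_trans _ _ (\sum_(i < k) c * t ^+ n * t ^+ i)).
    by apply: ler_sum => i _; rewrite -mulrA -exprD.
  rewrite -mulr_sumr [leRHS]mulrAC ler_wpM2l ?sum_geometric_le //.
  by rewrite mulr_ge0 // exprn_ge0.
have [l xl] : exists l : 'cV[R]_m, x @ \oo --> l.
  suff /cvg_ex : cvg (x @ \oo) by [].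
  apply/cauchy_cvgP/cauchyP => e e0.
  have : geometric (c / (1 - t)) t @ \oo --> (0 : R).
    by apply: cvg_geometric; rewrite ger0_norm.
  move=> /cvgrPdist_lt /(_ _ e0) [N _ HN]; exists (x N), N => // k /= Nk.
  rewrite -ball_normE /= distrC -(subnKC Nk).
  apply: le_lt_trans (xk _ _) _.
  have := HN N (leqnn N); rewrite sub0r normrN; apply: le_lt_trans.
  exact: ler_norm.
exists l => n; apply/ler_addgt0Pr => e e0.
have /cvgrPdist_lt /(_ _ e0) [N _ HN] := xl.
have /= := HN (n + N)%N (leq_addl _ _); move=> /ltW lN.
rewrite -(subrKA (x (n + N)%N)); apply: le_trans (ler_normD _ _) _.
by rewrite addrC lerD.
Qed.

(** * Exponential dichotomies on the half-line *)

Fixpoint transition (R : realType) (m : nat) (A : nat -> 'M[R]_m) (l n : nat) :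
    'M[R]_m :=
  if n is k.+1 then A (l + k)%N *m transition A l k else 1%:M.

Lemma invmx_mul (R : realType) (m : nat) (M N : 'M[R]_m) :
  M \in unitmx -> N \in unitmx -> invmx (M *m N) = invmx N *m invmx M.
Proof.
move=> Mu Nu; have MNu : M *m N \in unitmx by rewrite unitmx_mul Mu.
by apply: (can_inj (mulKmx MNu)); rewrite mulmxV // mulmxA mulmxK // mulmxV.
Qed.

Lemma transitionSl (R : realType) (m : nat) (A : nat -> 'M[R]_m) l n :
  transition A l n.+1 = transition A l.+1 n *m A l.
Proof.
elim: n => [|n IH]; first by rewrite /= addn0 mulmx1 mul1mx.
by rewrite [LHS]/= -/(transition A l n.+1) IH mulmxA addnS.
Qed.

Lemma transition_unit (R : realType) (m : nat) (A : nat -> 'M[R]_m) l n :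
  (forall k, A k \in unitmx) -> transition A l n \in unitmx.
Proof.
move=> Au; elim: n => [|n IH]; first exact: unitmx1.
by rewrite /= unitmx_mul Au.
Qed.

Lemma transition_orbit (R : realType) (m : nat) (A : nat -> 'M[R]_m)
  (x : nat -> 'cV[R]_m) l n :
  (forall k, x k.+1 = A k *m x k) -> transition A l n *m x l = x (l + n)%N.
Proof.
move=> xA; elim: n => [|n IH]; first by rewrite mul1mx addn0.
by rewrite /= -mulmxA IH addnS xA.
Qed.

(** [Q l] projects onto the directions that decay in forward time, along those
    that decay in backward time. The rates bound matrices rather than vectors,
    which makes the notion stable under transposition. *)
Definition dichotomy (R : realType) (m : nat) (A Q : nat -> 'M[R]_m) (C t : R) :
    Prop :=
  [/\ 0 <= C, 0 <= t, t < 1 & forall l,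
  [/\ A l \in unitmx, Q l *m Q l = Q l, Q l.+1 *m A l = A l *m Q l,
      forall n, `|transition A l n *m Q l| <= C * t ^+ n &
      forall n, `|invmx (transition A l n) *m (1%:M - Q (l + n)%N)|
                  <= C * t ^+ n]].

Lemma transition_commute (R : realType) (m : nat) (A Q : nat -> 'M[R]_m) l n :
  (forall k, Q k.+1 *m A k = A k *m Q k) ->
  Q (l + n)%N *m transition A l n = transition A l n *m Q l.
Proof.
move=> QA; elim: n => [|n IH]; first by rewrite addn0 mulmx1 mul1mx.
by rewrite /= addnS mulmxA QA -!mulmxA IH.
Qed.

Lemma transition_inv_commute (R : realType) (m : nat)
  (A Q : nat -> 'M[R]_m) l n :
  (forall k, A k \in unitmx) -> (forall k, Q k.+1 *m A k = A k *m Q k) ->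
  invmx (transition A l n) *m Q (l + n)%N =
  Q l *m invmx (transition A l n).
Proof.
move=> Au QA; have tu := transition_unit l n Au.
apply: (can_inj (mulKmx tu)).
by rewrite mulKVmx // mulmxA -(transition_commute _ _ QA) mulmxK.
Qed.

(** The forcing propagates from the past along the decaying directions, which
    is a finite sum on the half-line. *)
Lemma dichotomy_stable_solution (R : realType) (m : nat) (A Q : nat -> 'M[R]_m)
  (C t G : R) (g : nat -> 'cV[R]_m) :
  dichotomy A Q C t -> (forall l, `|g l| <= G) ->
  exists y : nat -> 'cV[R]_m,
  [/\ y 0%N = 0, forall l, y l.+1 = A l *m y l + Q l.+1 *m g l &
      forall l, `|y l| <= m%:R * C * G / (1 - t)].
Proof.
move=> [C0 t0 t1 D] gG.
have G0 : 0 <= G := le_trans (normr_ge0 _) (gG 0%N).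
pose S l := \sum_(j < l) transition A j.+1 (l - j.+1) *m Q j.+1 *m g j.
exists S; split=> [|l|l]; first by rewrite /S big_ord0.
  rewrite /S big_ord_recr /= subnn /= mul1mx mulmx_sumr; congr (_ + _).
  apply: eq_bigr => j _; rewrite subSn //= subnKC // !mulmxA //.
apply: le_trans (ler_norm_sum _ _ _) _.
apply: (@le_trans _ _ (\sum_(j < l) m%:R * C * G * t ^+ (l - j.+1))).
  apply: ler_sum => j _; apply: le_trans (normmx_mul _ _) _.
  have [_ _ _ /(_ (l - j.+1)%N) DQ _] := D j.+1.
  rewrite -!mulrA ler_wpM2l // [G * _]mulrC mulrA.
  by rewrite ler_pM.
rewrite (reindex_inj rev_ord_inj) /= -mulr_sumr.
rewrite (eq_bigr (fun i : 'I_l => t ^+ i)) => [|i _].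
  by rewrite ler_wpM2l ?sum_geometric_le // !mulr_ge0.
by congr (_ ^+ _); have := ltn_ord i; lia.
Qed.

(** In the other directions the solution is pulled back from the future. The
    series converges geometrically, and since the directions involved grow in
    forward time this is the only bounded choice. *)
Lemma dichotomy_unstable_solution (R : realType) (m : nat)
  (A Q : nat -> 'M[R]_m) (C t G : R) (g : nat -> 'cV[R]_m) :
  dichotomy A Q C t -> (forall l, `|g l| <= G) ->
  exists z : nat -> 'cV[R]_m,
  [/\ Q 0%N *m z 0%N = 0,
      forall l, z l.+1 = A l *m z l + (1%:M - Q l.+1) *m g l &
      forall l, `|z l| <= m%:R * C * G / (1 - t)].
Proof.
move=> [C0 t0 t1 D] gG.
have G0 : 0 <= G := le_trans (normr_ge0 _) (gG 0%N).
have Au k : A k \in unitmx by have [] := D k.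
have QQ k : Q k *m Q k = Q k by have [] := D k.
have QA k : Q k.+1 *m A k = A k *m Q k by have [] := D k.
have tu l n : transition A l n \in unitmx by exact: transition_unit.
pose T l n := invmx (transition A l n.+1) *m (1%:M - Q (l + n.+1)%N) *m
                g (l + n)%N.
pose S l n := - \sum_(i < n) T l i.
set c := m%:R * C * G.
have c0 : 0 <= c by rewrite !mulr_ge0.
have Tc l n : `|T l n| <= c * t ^+ n.
  apply: le_trans (normmx_mul _ _) _.
  have [_ _ _ _ /(_ n.+1) DQ] := D l.
  rewrite -!mulrA ler_wpM2l // [G * _]mulrC mulrA ler_pM //.
  apply: le_trans DQ _; rewrite ler_wpM2l // exprS ler_piMl ?exprn_ge0 //.
  exact: ltW.
have AT0 l : A l *m T l 0%N = (1%:M - Q l.+1) *m g l.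
  by rewrite /T /= mulmx1 addn0 addn1 -mulmxA mulKVmx.
have ATS l n : A l *m T l n.+1 = T l.+1 n.
  rewrite /T transitionSl invmx_mul // !mulmxA mulmxV // mul1mx.
  by rewrite !addSn !addnS.
have QT l n : Q l *m T l n = 0.
  rewrite /T !mulmxA.
  rewrite -(transition_inv_commute _ _ Au QA).
  by rewrite -[_ *m Q _ *m _]mulmxA mulmxBr mulmx1 QQ subrr mulmx0 mul0mx.
have Sd l n : `|S l n.+1 - S l n| <= c * t ^+ n.
  by rewrite /S big_ord_recr /= opprD addrAC subrr add0r normrN.
have /choice [z zS] := fun l => geometric_limit t0 t1 (Sd l).
have AS l n : A l *m S l n.+1 + (1%:M - Q l.+1) *m g l = S l.+1 n.
  rewrite /S big_ord_recl mulmxN mulmxDr AT0 addrC opprD addrA subrr add0r.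
  by rewrite mulmx_sumr; congr (- _); apply: eq_bigr => i _; rewrite ATS.
set k := c / (1 - t) in zS.
exists z; split=> [|l|l].
- apply/eqP; rewrite -normr_le0; apply: (@le0_geometric _ _
    (m%:R * `|Q 0%N| * k) t t0 t1) => n.
  have -> : Q 0%N *m z 0%N = Q 0%N *m (z 0%N - S 0%N n).
    by rewrite mulmxBr mulmxN mulmx_sumr big1 // oppr0 subr0.
  apply: le_trans (normmx_mul _ _) _.
  by rewrite -[leRHS]mulrA ler_wpM2l.
- apply/eqP; rewrite -subr_eq0 -normr_le0; apply: (@le0_geometric _ _
    (k + m%:R * `|A l| * k) t t0 t1) => n.
  have -> : z l.+1 - (A l *m z l + (1%:M - Q l.+1) *m g l) =
            (z l.+1 - S l.+1 n) - A l *m (z l - S l n.+1).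
    rewrite -AS mulmxBr.
    move: (A l *m z l) (A l *m S _ _) (_ *m g l) (z _) => a b d e.
    by rewrite opprB ![_ + d]addrC !opprD !addrA subrK.
  apply: le_trans (ler_normB _ _) _; rewrite mulrDl lerD //.
  apply: le_trans (normmx_mul _ _) _.
  rewrite -[leRHS]mulrA ler_wpM2l ?mulr_ge0 //.
  apply: le_trans (zS _ _) _; rewrite ler_wpM2l //.
    by rewrite divr_ge0 // subr_ge0 ltW.
  by rewrite exprS ler_piMl ?exprn_ge0 // ltW.
by have := zS l 0%N; rewrite /S big_ord0 oppr0 subr0 expr0 mulr1.
Qed.

(** The exponential dichotomy inverts the linear recursion on bounded
    sequences, with a bound that is uniform in the forcing. *)
Lemma dichotomy_bounded_solution (R : realType) (m : nat)
  (A Q : nat -> 'M[R]_m) (C t G : R) (g : nat -> 'cV[R]_m) :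
  dichotomy A Q C t -> (forall l, `|g l| <= G) ->
  exists x : nat -> 'cV[R]_m,
  [/\ Q 0%N *m x 0%N = 0, forall l, x l.+1 = A l *m x l + g l &
      forall l, `|x l| <= 2 * (m%:R * C / (1 - t)) * G].
Proof.
move=> D gG.
have [y [y0 yA yG]] := dichotomy_stable_solution D gG.
have [z [z0 zA zG]] := dichotomy_unstable_solution D gG.
exists (fun l => y l + z l); split=> [|l|l]; first by rewrite y0 add0r.
  by rewrite yA zA mulmxDr addrACA -mulmxDl [Q _ + _]addrC subrK mul1mx.
apply: le_trans (ler_normD _ _) _.
by apply: le_trans (lerD (yG l) (zG l)) _; apply: eq_ler; ring.
Qed.

(** A solution of the homogeneous recursion that starts in the backward
    decaying directions is recovered from its value in the far future, so
    boundedness forces it to vanish. *)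
Lemma dichotomy_bounded_unique (R : realType) (m : nat)
  (A Q : nat -> 'M[R]_m) (C t M : R) (x : nat -> 'cV[R]_m) :
  dichotomy A Q C t -> Q 0%N *m x 0%N = 0 -> (forall l, x l.+1 = A l *m x l) ->
  (forall l, `|x l| <= M) -> forall l, x l = 0.
Proof.
move=> [C0 t0 t1 D] x0 xA xM.
have QA k : Q k.+1 *m A k = A k *m Q k by have [] := D k.
have tu l n : transition A l n \in unitmx.
  by apply: transition_unit => k; have [] := D k.
suff x00 : x 0%N = 0 by elim=> [//|l IH]; rewrite xA IH mulmx0.
apply/eqP; rewrite -normr_le0; apply: (@le0_geometric _ _
  (m%:R * C * M) t t0 t1) => n.
have xn : transition A 0 n *m x 0%N = x n by rewrite transition_orbit.
have Qn : Q n *m x n = 0.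
  rewrite -xn mulmxA -[X in Q X]add0n (transition_commute _ _ QA).
  by rewrite -mulmxA x0 mulmx0.
have -> : x 0%N = invmx (transition A 0 n) *m (1%:M - Q n) *m x n.
  by rewrite -mulmxA mulmxBl mul1mx Qn subr0 -xn mulKmx.
apply: le_trans (normmx_mul _ _) _.
have [_ _ _ _ /(_ n)] := D 0%N; rewrite add0n => DQ.
by rewrite -!mulrA ler_wpM2l // [M * _]mulrC mulrA ler_pM.
Qed.

(** Inversion exchanges forward and backward decay, and transposition restores
    the order of the factors, so the adjoint recursion, read in forward time,
    inherits the dichotomy. *)
Lemma dichotomy_adjoint (R : realType) (m : nat) (A Q : nat -> 'M[R]_m)
  (C t : R) :
  dichotomy A Q C t ->
  dichotomy (fun l => invmx (A l)^T) (fun l => (1%:M - Q l)^T) C t.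
Proof.
move=> [C0 t0 t1 D].
have Au k : A k \in unitmx by have [] := D k.
have ATu k : (A k)^T \in unitmx by rewrite unitmx_tr.
have QQ k : Q k *m Q k = Q k by have [] := D k.
have QA k : Q k.+1 *m A k = A k *m Q k by have [] := D k.
have tu l n : transition A l n \in unitmx by exact: transition_unit.
have tuT l n : (transition A l n)^T \in unitmx by rewrite unitmx_tr.
have trans_adj l n : transition (fun l => invmx (A l)^T) l n =
                     invmx (transition A l n)^T.
  elim: n => [|n IH]; first by rewrite /= trmx1 invmx1.
  by rewrite /= IH trmx_mul invmx_mul.
split=> // l; split=> [||| n | n].
- by rewrite unitmx_inv.
- by rewrite -trmx_mul mulmxBl mul1mx mulmxBr mulmx1 QQ subrr subr0.
- have H : (A l)^T *m (1%:M - Q l.+1)^T = (1%:M - Q l)^T *m (A l)^T.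
    by rewrite -!trmx_mul mulmxBl mulmxBr mulmx1 mul1mx QA.
  apply: (can_inj (mulKmx (ATu l))); rewrite mulKVmx //.
  by rewrite mulmxA H mulmxK.
- have [_ _ _ _ /(_ n)] := D l.
  rewrite trans_adj -trmx_inv -trmx_mul normmx_tr.
  have -> // : (1%:M - Q l) *m invmx (transition A l n) =
     invmx (transition A l n) *m (1%:M - Q (l + n)%N).
  by rewrite mulmxBl mulmxBr mulmx1 mul1mx (transition_inv_commute _ _ Au QA).
have [_ _ _ /(_ n) DQ _] := D l.
rewrite trans_adj invmxK -[X in X - _]trmx1 -linearB -trmx_mul normmx_tr.
by rewrite /= opprB addrC subrK (transition_commute _ _ QA).
Qed.

(** * Uniform strict differentiability on compact sets *)

(** Continuity is uniform at the points of a compact set even against points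
    outside of it: perturbed orbits leave the set. *)
Lemma unif_continuous_near_compact (R : realType) (V : normedModType R)
  (G : V -> R) (K : set V) (e : R) :
  compact K -> continuous G -> 0 < e ->
  \forall r \near (0 : R)^'+, K `<=` [set a | forall x, `|x - a| < r ->
    `|G x - G a| < e].
Proof.
move=> /compact_near_coveringP Kc cG e0.
apply: (Kc R (0 : R)^'+ (fun r a => forall x, `|x - a| < r ->
    `|G x - G a| < e)) => a _.
have e2 : 0 < e / 2 by rewrite divr_gt0.
have /cvgrPdist_lt /(_ _ e2) /nbhs_ballP [d /= d0 dG] := cG a.
have d2 : 0 < d / 2 by rewrite divr_gt0.
exists (ball a (d / 2), [set r | r < d / 2]) => /=.
  by split; [exact: nbhsx_ballx | exact: nbhs_right_lt].
move=> [b r] /= [ab rd] x xb.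
have close y : `|y - a| < d -> `|G a - G y| < e / 2.
  by move=> ya; apply: dG; rewrite -ball_normE /= distrC.
have {ab}ab : `|b - a| < d / 2 by move: ab; rewrite -ball_normE /= distrC.
have /close Gb : `|b - a| < d by apply: lt_trans ab _; lra.
have /close Gx : `|x - a| < d.
  rewrite -(subrKA b); apply: le_lt_trans (ler_normD _ _) _.
  rewrite [ltRHS]splitr; apply: ltrD => //; exact: lt_trans xb rd.
rewrite -(subrKA (G a)) [ltRHS]splitr; apply: le_lt_trans (ler_normD _ _) _.
by rewrite ltrD // distrC.
Qed.

Lemma mean_value_segment (R : realType) (V : normedModType R) (F : V -> R)
  (p q : V) : (forall x, differentiable F x) ->
  exists c : R, [/\ 0 < c, c < 1 &
    F p - F q = 'd F (q + c *: (p - q)) (p - q)].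
Proof.
move=> dF; pose phi (c : R) := q + c *: (p - q).
have dphi (c : R) : is_diff c phi ( *:%R^~ (p - q)).
  by apply: is_diff_eq; apply/funext => h /=; rewrite add0r.
have dFphi (c : R) : is_derive c 1 (F \o phi) ('d F (phi c) (p - q)).
  have dcomp : differentiable (F \o phi) c by exact: differentiable_comp.
  apply: DeriveDef; first exact: diff_derivable.
  by rewrite deriveE // diff_comp //= diff_val scale1r.
have [|c] := @MVT R (F \o phi) (fun c => 'd F (phi c) (p - q)) 0 1 ltr01.

  apply: continuous_subspaceT => x; apply: differentiable_continuous.
  exact: differentiable_comp.
rewrite in_itv /= => /andP[c0 c1] E; exists c; split=> //.
move: E; rewrite /phi /= scale1r scale0r addr0 subr0 mulr1.
by rewrite [q + (p - q)]addrC subrK.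
Qed.

(** Every vector of [V] is a combination of finitely many vectors [b j] with
    coefficients bounded by its norm: this turns continuity of the differential
    in each direction into continuity in operator norm. *)
Lemma uniform_strict_diff_scalar (R : realType) (V : normedModType R)
  (I : finType) (b : I -> V) (co : V -> I -> R)
  (coE : forall h, h = \sum_j co h j *: b j)
  (co_le : forall h j, `|co h j| <= `|h|)
  (F : V -> R) (K : set V) (e : R) :
  (forall x, differentiable F x) ->
  (forall v, continuous (fun x => 'd F x v : R)) -> compact K -> 0 < e ->
  \forall r \near (0 : R)^'+, forall a, K a ->
    forall p q, `|p - a| < r -> `|q - a| < r ->
    `|F p - F q - 'd F a (p - q)| <= e * `|p - q|.
Proof.
move=> dF cdF Kc e0.
have n0 : 0 < (#|I|%:R + 1 : R) by rewrite ltr_pwDr.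
have ne : 0 < e / (#|I|%:R + 1) by rewrite divr_gt0.
have : \forall r \near (0 : R)^'+, forall j, K `<=` [set a | forall x,
    `|x - a| < r -> `|'d F x (b j) - 'd F a (b j)| < e / (#|I|%:R + 1)].
  by apply: filter_forall => j; exact: unif_continuous_near_compact.
apply: filterS => r Hr a Ka p q pa qa.
have [c [c0 c1 ->]] := mean_value_segment p q dF.
set x := q + _; set h := p - q.
have xa : `|x - a| < r.
  have -> : x - a = (1 - c) *: (q - a) + c *: (p - a).
    rewrite /x -[p - q](subrKA a) -(opprB q a) scalerDr scalerN scalerBl.
    by rewrite scale1r addrAC [c *: _ - _]addrC addrA.
  apply: le_lt_trans (ler_normD _ _) _.
  rewrite !normrZ !ger0_norm; [|lra|lra].
  have : (1 - c) * `|q - a| < (1 - c) * r by rewrite ltr_pM2l // subr_gt0.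
  have : c * `|p - a| < c * r by rewrite ltr_pM2l.
  lra.
have dFE y : 'd F y h = \sum_j co h j * 'd F y (b j) :> R.
  by rewrite {1}(coE h) linear_sum; apply: eq_bigr => j _; rewrite linearZ.
rewrite !dFE -sumrB.
apply: le_trans (ler_norm_sum _ _ _) _.
apply: (@le_trans _ _ (\sum_(j : I) `|h| * (e / (#|I|%:R + 1)))).
  apply: ler_sum => j _; rewrite -mulrBr normrM.
  by rewrite ler_pM //; apply/ltW/Hr.
rewrite sumr_const -[leLHS]mulr_natl.
have -> : #|I|%:R * (`|h| * (e / (#|I|%:R + 1))) =
          e * `|h| * (#|I|%:R / (#|I|%:R + 1)) by ring.
rewrite ler_piMr ?mulr_ge0 ?(ltW e0) //.
by rewrite ler_pdivrMr // mul1r lerDl.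
Qed.

(** State and parameter form one space, with the parameter direction indexed by
    the summand ['I_1]. *)
Definition prod_basis (R : realType) (m : nat) (j : 'I_m + 'I_1) :
    'cV[R]_m * R :=
  if j is inl i then (delta_mx i 0, 0) else (0, 1).

Definition prod_coord (R : realType) (m : nat) (h : 'cV[R]_m * R)
    (j : 'I_m + 'I_1) : R :=
  if j is inl i then h.1 i 0 else h.2.

Lemma prod_coordE (R : realType) (m : nat) (h : 'cV[R]_m * R) :
  h = \sum_j prod_coord h j *: prod_basis R j.
Proof.
rewrite big_sumType big_ord1 /=.
have scale_pair (c : R) (x : 'cV[R]_m) (d : R) :
    c *: ((x, d) : 'cV[R]_m * R) = (c *: x, c * d) by [].
have add_pair (x y : 'cV[R]_m) (c d : R) :
    (x, c) + (y, d) = (x + y, c + d) :> 'cV[R]_m * R by [].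
have -> : \sum_(i < m) h.1 i 0 *: (delta_mx i 0, 0) =
          (\sum_(i < m) h.1 i 0 *: delta_mx i 0, 0) :> 'cV[R]_m * R.
  rewrite (big_morph (fun y : 'cV[R]_m => (y, 0 : R))
    (id1 := 0) (op1 := +%R)) //.
    by apply: eq_bigr => i _; rewrite scale_pair mulr0.
  by move=> x y; rewrite add_pair addr0.
rewrite scale_pair add_pair scaler0 addr0 add0r mulr1 [LHS]surjective_pairing.
congr pair; rewrite [LHS]matrix_sum_delta.
by apply: eq_bigr => i _; rewrite big_ord1.
Qed.

Lemma prod_coord_le (R : realType) (m : nat) (h : 'cV[R]_m * R) j :
  `|prod_coord h j| <= `|h|.
Proof.
case: j => [i|] /=; rewrite prod_normE le_max.
  by rewrite normmx_entry.
by rewrite lexx orbT.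
Qed.

(** Newton steps and first-order expansions both compare two points near the
    compact set, so they need differentiability in the strict sense. *)
Lemma uniform_strict_diff (R : realType) (m n : nat)
  (F : 'cV[R]_m * R -> 'cV[R]_n) (K : set ('cV[R]_m * R)) (e : R) :
  (forall x, differentiable F x) ->
  (forall v, continuous (fun x => 'd F x v : 'cV[R]_n)) -> compact K -> 0 < e ->
  \forall r \near (0 : R)^'+, forall a, K a ->
    forall p q, `|p - a| < r -> `|q - a| < r ->
    `|F p - F q - 'd F a (p - q)| <= e * `|p - q|.
Proof.
move=> dF cdF Kc e0.
pose Fi i x := F x i 0.
have dFi i x : differentiable (Fi i) x.
  exact: (differentiable_comp (dF x) (differentiable_coord _ _ _)).
have dFiE i x h : 'd (Fi i) x h = 'd F x h i 0.
  rewrite (diff_comp (dF x) (differentiable_coord _ _ _)) /=.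
  have @co : {linear 'cV[R]_n -> R}.
    by exists (fun N : 'cV[R]_n => N i 0); do 2![eexists];
      do ?[constructor]; rewrite ?mxE // => ? *; rewrite ?mxE //;
      move=> ?; rewrite !mxE.
  have -> : (fun N : 'cV[R]_n => N i 0) = co by [].
  by rewrite diff_lin //; exact: coord_continuous.
have : \forall r \near (0 : R)^'+, forall i, forall a, K a ->
    forall p q, `|p - a| < r -> `|q - a| < r ->
    `|Fi i p - Fi i q - 'd (Fi i) a (p - q)| <= e * `|p - q|.
  apply: filter_forall => i.
  apply: (uniform_strict_diff_scalar (@prod_coordE R m) (@prod_coord_le R m))
    => // v x.
  have -> : (fun x => 'd (Fi i) x v : R) = (fun x => 'd F x v i 0).
    by apply/funext => y; rewrite dFiE.
  apply: (@continuous_comp _ _ _ (fun y => 'd F y v : 'cV[R]_n)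
    (fun N : 'cV[R]_n => N i 0)); first exact: cdF.
  exact: coord_continuous.
apply: filterS => r Hr a Ka p q pa qa.
apply: normmx_le => [|i j]; first by rewrite mulr_ge0 // ltW.
by rewrite ord1 !mxE -dFiE; exact: Hr.
Qed.

Lemma uniform_strict_diff_real (R : realType) (m : nat)
  (F : 'cV[R]_m * R -> R) (K : set ('cV[R]_m * R)) (e : R) :
  (forall x, differentiable F x) ->
  (forall v, continuous (fun x => 'd F x v : R)) -> compact K -> 0 < e ->
  \forall r \near (0 : R)^'+, forall a, K a ->
    forall p q, `|p - a| < r -> `|q - a| < r ->
    `|F p - F q - 'd F a (p - q)| <= e * `|p - q|.
Proof.
exact: (uniform_strict_diff_scalar (@prod_coordE R m) (@prod_coord_le R m)).
Qed.

Lemma compact_slice (R : realType) (m : nat) (K : set 'cV[R]_m) (s : R) :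
  compact K -> compact (K `*` [set s]).
Proof. by move=> Kc; apply: compact_setX => //; exact: compact_set1. Qed.

Lemma norm_pair_le (R : realType) (m : nat) (x : 'cV[R]_m) (t c : R) :
  `|x| <= c -> `|t| <= c -> `|(x, t) : 'cV[R]_m * R| <= c.
Proof. by move=> xc tc; rewrite prod_normE ge_max xc. Qed.

Lemma pairB (R : realType) (m : nat) (x y : 'cV[R]_m) (t c : R) :
  (x, t) - (y, c) = (x - y, t - c) :> 'cV[R]_m * R.
Proof. by []. Qed.

(** * Partial derivatives *)

Lemma mulmx_linear_cols (R : realType) (m n : nat)
  (L : {linear 'cV[R]_m -> 'cV[R]_n}) (v : 'cV[R]_m) :
  (\matrix_(i, j) (L (delta_mx j 0)) i 0) *m v = L v.
Proof.
rewrite {2}[v]matrix_sum_delta linear_sum; apply/colP => i.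
rewrite summxE mxE; apply: eq_bigr => j _.
by rewrite big_ord1 linearZ !mxE mulrC.
Qed.

Lemma derive_pair_fst (R : realType) (m : nat) (W : normedModType R)
  (F : 'cV[R]_m * R -> W) (u v : 'cV[R]_m) (s : R) :
  differentiable F (u, s) ->
  'D_v (fun x => F (x, s)) u = 'd F (u, s) (v, 0).
Proof.
move=> dF.
have di : is_diff u (fun x : 'cV[R]_m => (x, s)) (fun x => (x, 0)).
  exact: (is_diff_pair (is_diff_id u) (is_diff_cst s u)).
have du : differentiable (fun x : 'cV[R]_m => (x, s)) u by [].
rewrite -[fun x => _]/(F \o (fun x : 'cV[R]_m => (x, s))).
rewrite deriveE ?(diff_comp du dF) /= ?diff_val //.
exact: differentiable_comp.
Qed.

Lemma derive_pair_snd (R : realType) (m : nat) (W : normedModType R)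
  (F : 'cV[R]_m * R -> W) (u : 'cV[R]_m) (s : R) :
  differentiable F (u, s) ->
  derive1 (fun t => F (u, t)) s = 'd F (u, s) (0, 1).
Proof.
move=> dF.
have di : is_diff s (fun t : R => (u, t)) (fun t => (0, t)).
  exact: (is_diff_pair (is_diff_cst u s) (is_diff_id s)).
have ds : differentiable (fun t : R => (u, t)) s by [].
rewrite derive1E -[fun x => _]/(F \o (fun t : R => (u, t))).
rewrite deriveE ?(diff_comp ds dF) /= ?diff_val //.
exact: differentiable_comp.
Qed.

Lemma diff_pair_split (R : realType) (m : nat) (W : normedModType R)
  (F : 'cV[R]_m * R -> W) (a : 'cV[R]_m * R) (x : 'cV[R]_m) (t : R) :
  'd F a (x, t) = 'd F a (x, 0) + t *: 'd F a (0, 1).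
Proof.
have -> : (x, t) = (x, 0) + t *: (0, 1) :> 'cV[R]_m * R.
  by rewrite -[RHS]/(x + t *: 0, 0 + t * 1) scaler0 addr0 add0r mulr1.
by rewrite linearD linearZ.
Qed.

Lemma diff_f_uE (R : realType) (m : nat) (f : 'cV[R]_m -> R -> 'cV[R]_m)
  (u : 'cV[R]_m) (s : R) (x : 'cV[R]_m) (t : R) :
  differentiable (fun p : 'cV[R]_m * R => f p.1 p.2) (u, s) ->
  'd (fun p : 'cV[R]_m * R => f p.1 p.2) (u, s) (x, t) =
  f_u f u s *m x + t *: f_s f u s.
Proof.
set F := fun p => _; move=> dF; rewrite diff_pair_split; congr (_ + _ *: _).
  pose L (y : 'cV[R]_m) := 'd F (u, s) (y, 0).
  have Llin : linear L.
    move=> c y z; rewrite /L.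
    have -> : (c *: y + z, 0) = c *: (y, 0) + (z, 0) :> 'cV[R]_m * R.
      by rewrite -[RHS]/(c *: y + z, c * 0 + 0) mulr0 addr0.
    by rewrite linearP.
  pose LM := GRing.isLinear.Build _ _ _ _ _ Llin.
  pose LL : {linear 'cV[R]_m -> 'cV[R]_m} := HB.pack L LM.
  rewrite -[LHS]/(LL x) -mulmx_linear_cols; congr (_ *m _).
  apply/matrixP => i j; rewrite !mxE.
  have E := derive_pair_fst (delta_mx j 0) dF.
  exact: (congr1 (fun y : 'cV[R]_m => y i 0) (esym E)).
exact: (esym (derive_pair_snd dF)).
Qed.

Lemma diff_J_uE (R : realType) (m : nat) (J : 'cV[R]_m -> R -> R)
  (u : 'cV[R]_m) (s : R) (x : 'cV[R]_m) (t : R) :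
  differentiable (fun p : 'cV[R]_m * R => J p.1 p.2) (u, s) ->
  'd (fun p : 'cV[R]_m * R => J p.1 p.2) (u, s) (x, t) =
  dot (J_u J u s) x + t * J_s J u s.
Proof.
set F := fun p => _; move=> dF; rewrite diff_pair_split; congr (_ + _ * _).
  pose L (y : 'cV[R]_m) : R := 'd F (u, s) (y, 0).
  have Llin : linear (L : 'cV[R]_m -> R^o).
    move=> c y z; rewrite /L.
    have -> : (c *: y + z, 0) = c *: (y, 0) + (z, 0) :> 'cV[R]_m * R.
      by rewrite -[RHS]/(c *: y + z, c * 0 + 0) mulr0 addr0.
    by rewrite linearP.
  pose LM := GRing.isLinear.Build _ _ _ _ _ Llin.
  pose LL : {linear 'cV[R]_m -> R^o} := HB.pack (L : 'cV[R]_m -> R^o) LM.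
  rewrite -[LHS]/(LL x) [x in LL x]matrix_sum_delta linear_sum.
  apply: eq_bigr => i _; rewrite big_ord1 linearZ mxE mulrC.
  by congr (_ * _); exact: (esym (derive_pair_fst (delta_mx i 0) dF)).
exact: (esym (derive_pair_snd dF)).
Qed.

Lemma f_uE (R : realType) (m : nat) (f : 'cV[R]_m -> R -> 'cV[R]_m)
  (u : 'cV[R]_m) (s : R) (x : 'cV[R]_m) :
  differentiable (fun y => f y s) u ->
  f_u f u s *m x = 'd (fun y => f y s) u x.
Proof.
move=> df; rewrite -[RHS]mulmx_linear_cols; congr (_ *m _).
by apply/matrixP => i j; rewrite !mxE deriveE.
Qed.

Lemma f_u_unit (R : realType) (m : nat) (f : 'cV[R]_m -> R -> 'cV[R]_m)
  (u : 'cV[R]_m) (s : R) :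
  diffeomorphism (fun y => f y s) -> f_u f u s \in unitmx.
Proof.
move=> [fs [g [fK gK gs]]].
have df y : differentiable (fun y => f y s) y by have [] := fs 1%N.
have dg y : differentiable g y by have [] := gs 1%N.
pose G := \matrix_(i, j) ('d g (f u s) (delta_mx j 0)) i 0 : 'M[R]_m.
suff GF : G *m f_u f u s = 1%:M by have [] := mulmx1_unit GF.
apply/matrixP => i j.
have : (G *m f_u f u s) *m (delta_mx j 0 : 'cV[R]_m) = delta_mx j 0.
  rewrite -(mulmxA G) f_uE // mulmx_linear_cols.
  have := diff_comp (df u) (dg (f u s)).
  have -> : g \o (fun y => f y s) = id by apply/funext => y /=; rewrite fK.
  move=> /(congr1 (fun h => h (delta_mx j 0))) /= <-.
  by rewrite diff_val.
by move=> /matrixP /(_ i 0); rewrite -colE !mxE eqxx andbT.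
Qed.

Lemma compact_continuous_bounded (R : realType) (V W : normedModType R)
  (G : V -> W) (K : set V) :
  compact K -> continuous G -> exists M : R, forall a, K a -> `|G a| <= M.
Proof.
move=> Kc cG.
have : compact (G @` K).
  by apply: continuous_compact => //; exact: continuous_subspaceT.
move=> /compact_bounded [M [_ MG]]; exists (M + 1) => a Ka.
by apply: MG; [rewrite ltrDl | exists a].
Qed.

Lemma smooth_diff_bounded (R : realType) (m : nat) (W : normedModType R)
  (F : 'cV[R]_m * R -> W) (s : R) (K : set 'cV[R]_m) (v : 'cV[R]_m * R) :
  smooth F -> compact K ->
  exists M : R, forall a, K a -> `|'d F (a, s) v| <= M.
Proof.
move=> Fs Kc; have [_ cdF] := Fs 1%N.
have [M HM] := compact_continuous_bounded (compact_slice (s := s) Kc) (cdF v).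
by exists M => a Ka; exact: HM.
Qed.

Lemma f_s_bounded (R : realType) (m : nat) (f : 'cV[R]_m -> R -> 'cV[R]_m)
  (s : R) (K : set 'cV[R]_m) :
  smooth (fun p : 'cV[R]_m * R => f p.1 p.2) -> compact K ->
  exists M : R, forall a, K a -> `|f_s f a s| <= M.
Proof.
move=> fs Kc; have [dF _] := fs 1%N.
have [M HM] := smooth_diff_bounded s (0, 1) fs Kc.
exists M => a /HM.
by rewrite diff_f_uE // mulmx0 add0r scale1r.
Qed.

Lemma f_u_bounded (R : realType) (m : nat) (f : 'cV[R]_m -> R -> 'cV[R]_m)
  (s : R) (K : set 'cV[R]_m) :
  smooth (fun p : 'cV[R]_m * R => f p.1 p.2) -> compact K ->
  exists M : R, forall a, K a -> `|f_u f a s| <= M.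
Proof.
move=> fs Kc; have [dF _] := fs 1%N.
have [M HM] := choice (fun j => smooth_diff_bounded s (delta_mx j 0, 0) fs Kc).
exists (\sum_j `|M j|) => a Ka.
apply: normmx_le => [|i j]; first exact: sumr_ge0.
apply: (@le_trans _ _ `|M j|); last first.
  by rewrite (bigD1 j) //= lerDl sumr_ge0.
apply: le_trans (le_trans (HM j a Ka) (ler_norm _)).
rewrite diff_f_uE // scale0r addr0 -colE.
by have := normmx_entry (col j (f_u f a s)) i 0; rewrite mxE.
Qed.

Lemma J_u_bounded (R : realType) (m : nat) (J : 'cV[R]_m -> R -> R)
  (s : R) (K : set 'cV[R]_m) :
  smooth (fun p : 'cV[R]_m * R => J p.1 p.2) -> compact K ->
  exists M : R, forall a, K a -> `|J_u J a s| <= M.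
Proof.
move=> Js Kc; have [dJ _] := Js 1%N.
have [M HM] := choice (fun i => smooth_diff_bounded s (delta_mx i 0, 0) Js Kc).
exists (\sum_i `|M i|) => a Ka.
apply: normmx_le => [|i j]; first exact: sumr_ge0.
apply: (@le_trans _ _ `|M i|); last first.
  by rewrite (bigD1 i) //= lerDl sumr_ge0.
apply: le_trans (le_trans (HM i a Ka) (ler_norm _)).
rewrite diff_J_uE // mul0r addr0 ord1 /dot (bigD1 i) //= big1 => [|k ki].
  by rewrite [delta_mx _ _ _ _]mxE !eqxx mulr1 addr0.
by rewrite [delta_mx _ _ _ _]mxE (negbTE ki) mulr0.
Qed.

(** * The Euclidean structure *)

Lemma norm_le_enorm (R : realType) (m : nat) (x : 'cV[R]_m) : `|x| <= enorm x.
Proof.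
apply: normmx_le => [|i j]; first exact: sqrtr_ge0.
rewrite ord1 -sqrtr_sqr /enorm ler_wsqrtr // /dot (bigD1 i) //= -expr2 lerDl.
by apply: sumr_ge0 => k _; rewrite -expr2 sqr_ge0.
Qed.

Lemma enorm_le_norm (R : realType) (m : nat) (x : 'cV[R]_m) :
  enorm x <= m%:R * `|x|.
Proof.
rewrite -[leRHS]ger0_norm ?mulr_ge0 // -sqrtr_sqr ler_wsqrtr //.
apply: (@le_trans _ _ (m%:R * `|x| ^+ 2)).
  rewrite mulr_natl -[m in _ *+ m]card_ord -sumr_const.
  apply: ler_sum => i _; rewrite -expr2 -real_normK ?num_real //.
  by rewrite ler_sqr ?nnegrE // normmx_entry.
rewrite exprMn ler_wpM2r ?exprn_ge0 // -natrX ler_nat.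
by case: (m) => // k; rewrite -mulnn leq_pmulr.
Qed.

Lemma dot_le (R : realType) (m : nat) (x y : 'cV[R]_m) :
  `|dot x y| <= m%:R * `|x| * `|y|.
Proof.
apply: le_trans (ler_norm_sum _ _ _) _.
rewrite -mulrA mulr_natl -[m in _ *+ m]card_ord -sumr_const.
by apply: ler_sum => i _; rewrite normrM ler_pM // normmx_entry.
Qed.

Lemma dotDl (R : realType) (m : nat) (x y z : 'cV[R]_m) :
  dot (x + y) z = dot x z + dot y z.
Proof. by rewrite -big_split; apply: eq_bigr => i _; rewrite mxE mulrDl. Qed.

Lemma dotDr (R : realType) (m : nat) (x y z : 'cV[R]_m) :
  dot x (y + z) = dot x y + dot x z.
Proof. by rewrite -big_split; apply: eq_bigr => i _; rewrite mxE mulrDr. Qed.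

Lemma dotZr (R : realType) (m : nat) (c : R) (x y : 'cV[R]_m) :
  dot x (c *: y) = c * dot x y.
Proof.
by rewrite /dot mulr_sumr; apply: eq_bigr => i _; rewrite mxE mulrCA.
Qed.

Lemma dot_mulmx (R : realType) (m n : nat) (M : 'M[R]_(m, n)) (x : 'cV[R]_m)
  (y : 'cV[R]_n) : dot x (M *m y) = dot (M^T *m x) y.
Proof.
have dotE k (a b : 'cV[R]_k) : dot a b = (a^T *m b) 0 0.
  by rewrite mxE; apply: eq_bigr => i _; rewrite mxE.
by rewrite !dotE trmx_mul trmxK mulmxA.
Qed.

(** * From the hyperbolic splitting to a dichotomy *)

(** The hyperbolic estimates hold along two-sided orbits; invertibility provides
    a past for a forward orbit. *)
Lemma full_trajectory_extension (R : realType) (m : nat)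
  (f : 'cV[R]_m -> R -> 'cV[R]_m) (s : R) (g : 'cV[R]_m -> 'cV[R]_m)
  (u : nat -> 'cV[R]_m) :
  cancel g (fun y => f y s) -> trajectory f s u ->
  exists w : int -> 'cV[R]_m,
    full_trajectory f s w /\ forall n : nat, w n%:Z = u n.
Proof.
move=> gK uf.
exists (fun i => match i with
        | Posz n => u n | Negz n => iter n.+1 g (u 0%N) end).
split=> // -[n|[|n]]; first by rewrite addrC -intS uf.
  by rewrite /= gK.
have -> : Negz n.+1 + 1 = Negz n by rewrite !NegzE; lia.
by rewrite [in RHS]/= gK.
Qed.

Lemma tangent_prop_fwd (R : realType) (m : nat)
  (f : 'cV[R]_m -> R -> 'cV[R]_m) (s : R) (w : int -> 'cV[R]_m)
  (u : nat -> 'cV[R]_m) (l n : nat) :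
  (forall k : nat, w k%:Z = u k) ->
  tangent_prop f s (fun i => w (i + l%:Z)) 0 n%:Z =
  transition (fun k => f_u f (u k) s) l n.
Proof.
move=> wu; rewrite /tangent_prop le0z_nat subr0 absz_nat.
elim: n => [//|n IH].
rewrite -[LHS]/(f_u f (w (0 + n%:Z + l%:Z)) s *m
  prop_fwd f s (fun i => w (i + l%:Z)) 0 n) IH.
by rewrite add0r addrC -PoszD wu.
Qed.

Lemma tangent_prop_bwd (R : realType) (m : nat)
  (f : 'cV[R]_m -> R -> 'cV[R]_m) (s : R) (w : int -> 'cV[R]_m)
  (u : nat -> 'cV[R]_m) (l n : nat) :
  (forall k, f_u f (u k) s \in unitmx) -> (forall k : nat, w k%:Z = u k) ->
  tangent_prop f s (fun i => w (i + (l + n.+1)%N%:Z)) 0 (- n.+1%:Z) =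
  invmx (transition (fun k => f_u f (u k) s) l n.+1).
Proof.
move=> Au wu; rewrite /tangent_prop; have -> : (0 <= - n.+1%:Z) = false by lia.
rewrite subr0 abszN absz_nat.
set N := n.+1; set A := fun k => f_u f (u k) s.
suff H k : (k <= N)%N -> prop_bwd f s (fun i => w (i + (l + N)%N%:Z)) 0 k =
    invmx (transition A (l + (N - k)) k) by rewrite H // subnn addn0.
have AAu i : A i \in unitmx by exact: Au.
elim: k => [|k IH] kN; first by rewrite /= invmx1.
rewrite transitionSl invmx_mul ?transition_unit ?AAu //.
have -> : (l + (N - k.+1)).+1 = (l + (N - k))%N by lia.
rewrite -[LHS]/(invmx (f_u f (w (0 - k.+1%:Z + (l + N)%N%:Z)) s) *m
  prop_bwd f s (fun i => w (i + (l + N)%N%:Z)) 0 k) IH; last exact: ltnW.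
have -> : 0 - k.+1%:Z + (l + N)%N%:Z = (l + (N - k.+1))%N%:Z by lia.
by rewrite wu.
Qed.

Lemma hyperbolic_rates (R : realType) (m : nat)
  (f : 'cV[R]_m -> R -> 'cV[R]_m) (s : R) (K : set 'cV[R]_m)
  (Vp Vm : 'cV[R]_m -> {vspace 'cV[R]_m}) (u : nat -> 'cV[R]_m) :
  diffeomorphism (fun y => f y s) -> hyperbolic_splitting f s K Vp Vm ->
  trajectory f s u -> (forall l, K (u l)) ->
  let A k := f_u f (u k) s in
  exists C t : R, [/\ 0 <= C, 0 <= t, t < 1 & forall l n v,
    (v \in Vm (u l) -> `|transition A l n *m v| <= C * t ^+ n * `|v|) /\
    (v \in Vp (u (l + n)%N) ->
       `|invmx (transition A l n) *m v| <= C * t ^+ n * `|v|)].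
Proof.
move=> fdiff [C [lam [C0 lam0 hyp]]] uf uK A.
have Au k : A k \in unitmx by exact: f_u_unit.
have [_ [g [_ gK _]]] := fdiff.
have [w [wf wu]] := full_trajectory_extension gK uf.
have wlf (l : nat) : full_trajectory f s (fun i => w (i + l%:Z)).
  by move=> i; rewrite addrAC wf.
have Cm0 : 0 <= C * m%:R by rewrite mulr_ge0 // ltW.
have expE n : expR (- lam * n%:R) = expR (- lam) ^+ n.
  by rewrite mulrC expRM_natl.
have toNorm (M : 'M[R]_m) (v : 'cV[R]_m) n :
    enorm (M *m v) <= C * expR (- lam * n%:R) * enorm v ->
    `|M *m v| <= (C * m%:R + 1) * expR (- lam) ^+ n * `|v|.
  move=> Mv; apply: le_trans (norm_le_enorm _) _; apply: le_trans Mv _.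
  rewrite expE; apply: (@le_trans _ _ (C * expR (- lam) ^+ n * (m%:R * `|v|))).
    by rewrite ler_wpM2l ?enorm_le_norm // mulr_ge0 ?exprn_ge0 ?expR_ge0 // ltW.
  rewrite mulrA ler_wpM2r // mulrAC ler_wpM2r ?exprn_ge0 ?expR_ge0 //.
  by rewrite lerDl.
(* The factor [m] compares the Euclidean norm with the sup norm; adding [1]
   covers the time step [n = 0], where the estimates say nothing. *)
exists (C * m%:R + 1), (expR (- lam)); split.
- by rewrite addr_ge0.
- exact: expR_ge0.
- by rewrite expR_lt1 oppr_lt0.
move=> l [|n] v.
  rewrite /= invmx1 mul1mx mulr1; split=> _;
  by rewrite ler_peMl // lerDr.
split=> vV; apply: toNorm.
  have [_ _ /(_ _ (wlf l))] := hyp _ (uK l).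
  rewrite add0r wu => /(_ erefl) [_ /(_ v n.+1%:Z vV)].
  by rewrite (tangent_prop_fwd _ _ _ _ wu) absz_nat; apply.
have [_ _ /(_ _ (wlf (l + n.+1)%N))] := hyp _ (uK (l + n.+1)%N).
rewrite add0r wu => /(_ erefl) [/(_ v (- n.+1%:Z) vV) + _].
by rewrite (tangent_prop_bwd _ _ Au wu) abszN absz_nat; apply; lia.
Qed.

Lemma transition_bound (R : realType) (m : nat) (A : nat -> 'M[R]_m) (M : R)
  (l n : nat) (x : 'cV[R]_m) :
  (forall k, `|A k| <= M) ->
  `|transition A l n *m x| <= (m%:R * M) ^+ n * `|x|.
Proof.
move=> AM; have M0 : 0 <= M := le_trans (normr_ge0 _) (AM 0%N).
elim: n => [|n IH]; first by rewrite mul1mx mul1r.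
rewrite /= -mulmxA exprS -mulrA; apply: le_trans (normmx_mul _ _) _.
by rewrite ler_pM // ?mulr_ge0 // ler_wpM2l.
Qed.

(** Over a long enough time the growth of an unstable vector beats the decay of
    a stable one, so their sum cannot be much smaller than either of them: the
    angle between the two subspaces is bounded below along the orbit. *)
Lemma splitting_angle (R : realType) (m : nat) (A : nat -> 'M[R]_m)
  (Vp Vm : nat -> {vspace 'cV[R]_m}) (C t M : R) :
  0 <= C -> 0 <= t -> t < 1 -> (forall k, `|A k| <= M) ->
  (forall k, A k \in unitmx) ->
  (forall k v, v \in Vp k -> A k *m v \in Vp k.+1) ->
  (forall l n v, v \in Vm l -> `|transition A l n *m v| <= C * t ^+ n * `|v|) ->
  (forall l n v, v \in Vp (l + n)%N ->
     `|invmx (transition A l n) *m v| <= C * t ^+ n * `|v|) ->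
  exists2 B : R, 0 <= B & forall l v w, v \in Vp l -> w \in Vm l ->
    `|v| <= B * `|v + w|.
Proof.
move=> C0 t0 t1 AM Au AVp ratem ratep.
have M0 : 0 <= M := le_trans (normr_ge0 _) (AM 0%N).
(* In [N] steps the growth, at least [t ^- N / C], exceeds twice the bound [C]
   for stable vectors. *)
have [N CtN] : exists N, C ^+ 2 * t ^+ N <= 2^-1.
  have : geometric (C ^+ 2) t @ \oo --> (0 : R).
    by apply: cvg_geometric; rewrite ger0_norm.
  have half0 : 0 < 2^-1 :> R by rewrite invr_gt0.
  move=> /cvgrPdist_le /(_ _ half0) [N _ /(_ N (leqnn N)) /=].
  by rewrite sub0r normrN => H; exists N; apply: le_trans H; exact: ler_norm.
have tN0 : 0 <= t ^+ N by rewrite exprn_ge0.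
have tN1 : t ^+ N <= 1 by rewrite exprn_ile1 // ltW.
set L := (m%:R * M) ^+ N.
have L0 : 0 <= L by rewrite exprn_ge0 // mulr_ge0.
exists (2 * C * L + 1) => [|l v w vVp wVm].
  by rewrite addr_ge0 // !mulr_ge0.
set Phi := transition A l N.
have Phiu : Phi \in unitmx by exact: transition_unit.
have PhiVp n : transition A l n *m v \in Vp (l + n)%N.
  elim: n => [|n IH]; first by rewrite mul1mx addn0.
  by rewrite addnS /= -mulmxA AVp.
have v1 : `|v| <= C * t ^+ N * `|Phi *m v|.
  by rewrite -{1}(mulKmx Phiu v); exact: (ratep l N _ (PhiVp N)).
have v2 : `|Phi *m v| <= L * `|v + w| + C * t ^+ N * `|w|.
  rewrite -[v in Phi *m v](addrK w) mulmxBr.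
  apply: le_trans (ler_normB _ _) _.
  by rewrite lerD //; [exact: transition_bound | exact: ratem].
have w1 : `|w| <= `|v + w| + `|v|.
  by have := ler_normB (v + w) v; rewrite addrAC subrr add0r.
have {v2}v1 := le_trans v1 (ler_wpM2l (mulr_ge0 C0 tN0) v2).
have h1 : C * t ^+ N * (L * `|v + w|) <= C * (L * `|v + w|).
  by rewrite ler_wpM2r ?mulr_ge0 // ler_piMr.
have h2 : C * t ^+ N * (C * t ^+ N * `|w|) <= 2^-1 * (`|v + w| + `|v|).
  have -> : C * t ^+ N * (C * t ^+ N * `|w|) =
            (C ^+ 2 * t ^+ N) * (t ^+ N * `|w|) by ring.
  rewrite ler_pM // ?mulr_ge0 // ?exprn_ge0 //.
  by apply: le_trans w1; rewrite ler_piMl.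
rewrite mulrDr in v1; have := le_trans v1 (lerD h1 h2).
by lra.
Qed.

Lemma proj_matrixE (R : realType) (m : nat) (V W : {vspace 'cV[R]_m})
  (v : 'cV[R]_m) : proj_matrix V W *m v = daddv_pi V W v.
Proof. exact: mulmx_linear_cols. Qed.

Lemma eq_mulmx_cV (R : realType) (m n : nat) (M N : 'M[R]_(m, n)) :
  (forall v : 'cV[R]_n, M *m v = N *m v) -> M = N.
Proof.
move=> MN; apply/matrixP => i j.
by have /matrixP /(_ i 0) := MN (delta_mx j 0); rewrite -!colE !mxE.
Qed.

(** The bounds of [hyperbolic_rates] hold on the two subspaces; the uniform
    bound on the projections of [splitting_angle] turns them into bounds on
    matrices. *)
Lemma hyperbolic_dichotomy (R : realType) (m : nat)
  (f : 'cV[R]_m -> R -> 'cV[R]_m) (s : R) (K : set 'cV[R]_m)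
  (Vp Vm : 'cV[R]_m -> {vspace 'cV[R]_m}) (u : nat -> 'cV[R]_m) :
  smooth (fun p : 'cV[R]_m * R => f p.1 p.2) -> compact K ->
  diffeomorphism (fun y => f y s) -> hyperbolic_splitting f s K Vp Vm ->
  trajectory f s u -> (forall l, K (u l)) ->
  exists C t : R, dichotomy (fun k => f_u f (u k) s)
    (fun k => 1%:M - proj_matrix (Vp (u k)) (Vm (u k))) C t.
Proof.
move=> fs Kc fdiff hyp uf uK.
have [C [t [C0 t0 t1 rates]]] := hyperbolic_rates fdiff hyp uf uK.
set A := fun k => f_u f (u k) s in rates *.
have Au k : A k \in unitmx by exact: f_u_unit.
have [M AM] := f_u_bounded s fs Kc.
have [C1 [lam [_ _ inv]]] := hyp.
have dsum k : (Vp (u k) + Vm (u k))%VS = fullv by have [[]] := inv _ (uK k).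
have dcap k : (Vp (u k) :&: Vm (u k))%VS = 0%VS by have [[]] := inv _ (uK k).
have AVp k v : v \in Vp (u k) -> A k *m v \in Vp (u k.+1).
  by have [_ [Hp _] _] := inv _ (uK k); rewrite uf -Hp.
have AVm k v : v \in Vm (u k) -> A k *m v \in Vm (u k.+1).
  by have [_ [_ Hm] _] := inv _ (uK k); rewrite uf -Hm.
have [B B0 angle] := splitting_angle (Vp := Vp \o u) (Vm := Vm \o u) C0 t0 t1
  (fun k => AM _ (uK k)) Au AVp (fun l n v => (rates l n v).1)
  (fun l n v => (rates l n v).2).
pose P k := proj_matrix (Vp (u k)) (Vm (u k)).
have PVp k v : P k *m v \in Vp (u k) by rewrite proj_matrixE memv_pi.
have QVm k v : (1%:M - P k) *m v \in Vm (u k).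
  rewrite mulmxBl mul1mx proj_matrixE.
  have := daddv_pi_add (dcap k) (_ : v \in Vp (u k) + Vm (u k))%VS.
  by rewrite dsum memvf => /(_ isT) {1}<-; rewrite addrC addKr memv_pi.
have Pid k v : v \in Vp (u k) -> P k *m v = v.
  by move=> vV; rewrite proj_matrixE daddv_pi_id.
have PQ k (v : 'cV[R]_m) : P k *m v + (1%:M - P k) *m v = v.
  by rewrite -mulmxDl addrC subrK mul1mx.
have P0 k v : v \in Vm (u k) -> P k *m v = 0.
  move=> vV; apply/eqP; rewrite -memv0 -(dcap k) memv_cap PVp /=.
  by rewrite -[P k *m v](addrK ((1%:M - P k) *m v)) PQ rpredB.
have Ple k (v : 'cV[R]_m) : `|P k *m v| <= B * `|v|.
  by have := angle k _ _ (PVp k v) (QVm k v); rewrite PQ.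
have Qle k (v : 'cV[R]_m) : `|(1%:M - P k) *m v| <= (1 + B) * `|v|.
  by rewrite mulmxBl mul1mx (le_trans (ler_normB _ _)) // mulrDl mul1r lerD.
have delta1 j : `|delta_mx j 0 : 'cV[R]_m| <= 1.
  apply: normmx_le => // i k; rewrite mxE.
  by case: (_ && _); rewrite ?normr1 ?normr0.
have colbound (N : 'M[R]_m) c : 0 <= c ->
    (forall v : 'cV[R]_m, `|N *m v| <= c * `|v|) -> `|N| <= c.
  move=> c0 Nc; apply: normmx_le => // i j.
  have := normmx_entry (N *m (delta_mx j 0 : 'cV[R]_m)) i 0.
  rewrite -colE mxE => /le_trans; apply; rewrite colE.
  by apply: le_trans (Nc _) _; rewrite ler_piMr.
exists (C * (1 + B)), t; split=> //; first by rewrite mulr_ge0 // addr_ge0.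
move=> l; split=> //.
- apply: eq_mulmx_cV => v; rewrite -mulmxA [LHS]mulmxBl mul1mx.
  by rewrite [P l *m _]P0 ?QVm // subr0.
- rewrite mulmxBl mulmxBr mul1mx mulmx1; congr (_ - _).
  apply: eq_mulmx_cV => v; rewrite -!mulmxA -{1}[v](PQ l) !mulmxDr.
  rewrite -/(P l.+1) -/(P l) [P l.+1 *m (A l *m (P l *m v))]Pid ?AVp //.
  by rewrite [P l.+1 *m (A l *m ((1%:M - P l) *m v))]P0 ?AVm // addr0.
- move=> n; apply: colbound => [|v].
    by rewrite !mulr_ge0 ?exprn_ge0 ?addr_ge0.
  rewrite -mulmxA; apply: le_trans ((rates l n _).1 (QVm l v)) _.
  rewrite [C * (1 + B) * _]mulrAC -[leRHS]mulrA ler_wpM2l //.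
  by rewrite mulr_ge0 ?exprn_ge0.
move=> n; apply: colbound => [|v].
  by rewrite !mulr_ge0 ?exprn_ge0 ?addr_ge0.
rewrite opprB addrC subrK -mulmxA.
apply: le_trans ((rates l n _).2 (PVp _ v)) _.
rewrite [C * (1 + B) * _]mulrAC -[leRHS]mulrA ler_wpM2l ?mulr_ge0 ?exprn_ge0 //.
by apply: le_trans (Ple _ _) _; rewrite ler_wpM2r // lerDr.
Qed.

(** * Shadowing orbits of the perturbed system *)

(** A pseudo-orbit [w0] with small defect is corrected by Newton steps whose
    linearization is frozen along the nearby orbit [u]: solving the linear
    recursion for the defect halves it at each step. *)
Lemma newton_shadowing (R : realType) (m : nat) (G : 'cV[R]_m -> 'cV[R]_m)
  (A : nat -> 'M[R]_m) (u w0 : nat -> 'cV[R]_m) (S h r c : R) :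
  0 <= S -> 0 <= h -> h * S <= 2^-1 ->
  (forall g c', (forall l, `|g l| <= c') -> exists x : nat -> 'cV[R]_m,
    (forall l, x l.+1 = A l *m x l + g l) /\ (forall l, `|x l| <= S * c')) ->
  (forall l x y, `|x - u l| < r -> `|y - u l| < r ->
    `|G x - G y - A l *m (x - y)| <= h * `|x - y|) ->
  (forall l, `|w0 l - u l| + 2 * S * c < r) ->
  (forall l, `|G (w0 l) - w0 l.+1| <= c) ->
  exists w : nat -> 'cV[R]_m,
    (forall l, w l.+1 = G (w l)) /\ forall l, `|w l - w0 l| <= 2 * S * c.
Proof.
move=> S0 h0 hS solve strict w0r w0c.
have c0 : 0 <= c := le_trans (normr_ge0 _) (w0c 0%N).
have half_ge0 : 0 <= 2^-1 :> R by rewrite invr_ge0.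
have half_lt1 : 2^-1 < 1 :> R by rewrite invf_lt1 // ltr1n.
have hn_ge0 n : 0 <= 2^-1 ^+ n :> R by rewrite exprn_ge0.
(* A solution is chosen for each forcing together with a bound on it, since the
   estimate on the solution refers to the bound. *)
have /choice [sol solP] (p : (nat -> 'cV[R]_m) * R) :
    exists x : nat -> 'cV[R]_m, (forall l, `|p.1 l| <= p.2) ->
    (forall l, x l.+1 = A l *m x l + p.1 l) /\ (forall l, `|x l| <= S * p.2).
  have [/solve [x xP]|no] := pselect (forall l, `|p.1 l| <= p.2).
    by exists x.
  by exists (fun=> 0) => /no.
pose defect (w : nat -> 'cV[R]_m) l := G (w l) - w l.+1.
pose step (w : nat -> 'cV[R]_m) k := sol (defect w, c * 2^-1 ^+ k).
pose w := fix w k := if k is k'.+1 then fun l => w k' l + step (w k') k' l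
                     else w0.
have wS k l : w k.+1 l = w k l + step (w k) k l by [].
have near_u k l : `|w k l - w0 l| <= 2 * S * c -> `|w k l - u l| < r.
  move=> H; rewrite -(subrKA (w0 l)); apply: le_lt_trans (ler_normD _ _) _.
  by apply: le_lt_trans (w0r l); rewrite addrC lerD2l.
have newton_bounds k : (forall l, `|defect (w k) l| <= c * 2^-1 ^+ k) /\
    (forall l, `|w k l - w0 l| <= 2 * S * c * (1 - 2^-1 ^+ k)).
  elim: k => [|k [IHd IHw]].
    by split=> l; rewrite ?expr0 ?mulr1 ?subrr ?mulr0 ?normr0 //; exact: w0c.
  have [eA eS] := solP (defect (w k), c * 2^-1 ^+ k) IHd.
  rewrite -/(step (w k) k) /= in eA eS.
  have wk1 l : `|w k.+1 l - w0 l| <= 2 * S * c * (1 - 2^-1 ^+ k.+1).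
    rewrite wS addrAC; apply: le_trans (ler_normD _ _) _.
    apply: le_trans (lerD (IHw l) (eS l)) _.
    by apply: eq_ler; rewrite exprS; field.
  have tail n : 2 * S * c * (1 - 2^-1 ^+ n) <= 2 * S * c.
    by rewrite ler_piMr ?mulr_ge0 // gerBl.
  split=> // l.
  have -> : defect (w k.+1) l =
      G (w k.+1 l) - G (w k l) - A l *m (w k.+1 l - w k l).
    rewrite /defect [w k.+1 l.+1]wS eA [w k.+1 l - w k l]addrC [in RHS]wS addKr.
    rewrite /defect; move: (A l *m _) (G _) (G _) (w k l.+1) => a b d e.
    by rewrite [e + _]addrC addrA subrK opprD addrA addrAC.
  apply: le_trans (strict _ _ _ _ _) _.
  - by apply: near_u; apply: le_trans (wk1 l) (tail _).
  - by apply: near_u; apply: le_trans (IHw l) (tail _).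
  rewrite [w k.+1 l - w k l]addrC [w k.+1 l]wS addKr.
  apply: le_trans (ler_wpM2l h0 (eS l)) _.
  rewrite (mulrA h) [in leRHS]exprS [leRHS]mulrCA.
  by apply: ler_wpM2r => //; rewrite mulr_ge0.
have defk k l : `|defect (w k) l| <= c * 2^-1 ^+ k.
  by have [] := newton_bounds k.
have wk k l : `|w k l - w0 l| <= 2 * S * c.
  have [_ /(_ l) H] := newton_bounds k; apply: le_trans H _.
  by rewrite ler_piMr ?mulr_ge0 // gerBl.
have wd l k : `|w k.+1 l - w k l| <= S * c * 2^-1 ^+ k.
  rewrite wS addrC addKr -mulrA.
  by have [_ /(_ l)] := solP (defect (w k), c * 2^-1 ^+ k) (defk k).
have /choice [z zP] := fun l => geometric_limit half_ge0 half_lt1 (wd l).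
have E2 : S * c / (1 - 2^-1) = 2 * S * c by field.
have zw0 l : `|z l - w0 l| <= 2 * S * c.
  by have := zP l 0%N; rewrite E2 expr0 mulr1.
exists z; split=> // l.
apply/eqP; rewrite eq_sym -subr_eq0 -normr_le0.
apply: (@le0_geometric _ _
  ((m%:R * `|A l| + h) * (2 * S * c) + c + 2 * S * c) 2^-1) => // k.
have -> : G (z l) - z l.+1 = (G (z l) - G (w k l) - A l *m (z l - w k l)) +
    A l *m (z l - w k l) + defect (w k) l - (z l.+1 - w k l.+1).
  by rewrite subrK /defect subrKA opprB subrKA.
have zwk l' : `|z l' - w k l'| <= 2 * S * c * 2^-1 ^+ k.
  by rewrite -E2; exact: zP.
apply: le_trans (ler_normB _ _) _; rewrite [leRHS]mulrDl lerD //.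
apply: le_trans (ler_normD _ _) _; rewrite [leRHS]mulrDl lerD //.
apply: le_trans (ler_normD _ _) _; rewrite mulrDl mulrDl addrC lerD //.
  apply: le_trans (normmx_mul _ _) _; by rewrite -[leRHS]mulrA ler_wpM2l.
apply: le_trans (strict _ _ _ _ _) _.
- rewrite -(subrKA (w0 l)); apply: le_lt_trans (ler_normD _ _) _.
  by apply: le_lt_trans (w0r l); rewrite addrC lerD2l.
- exact: near_u.
by rewrite -[leRHS]mulrA ler_wpM2l.
Qed.

(** Moving the orbit [u] along the tangent solution [v] leaves a defect that is
    small compared with [d], by strict differentiability at [u]; the Newton
    correction of that defect is then small compared with [d] too. *)
Lemma shadowing_orbits (R : realType) (m : nat)
  (f : 'cV[R]_m -> R -> 'cV[R]_m) (s : R) (K : set 'cV[R]_m)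
  (u v : nat -> 'cV[R]_m) (S V e : R) :
  smooth (fun p : 'cV[R]_m * R => f p.1 p.2) -> compact K ->
  trajectory f s u -> (forall l, K (u l)) ->
  0 < S -> (forall g G, (forall l, `|g l| <= G) -> exists x : nat -> 'cV[R]_m,
    (forall l, x l.+1 = f_u f (u l) s *m x l + g l) /\
    (forall l, `|x l| <= S * G)) ->
  (forall l, v l.+1 = f_u f (u l) s *m v l + f_s f (u l) s) ->
  1 <= V -> (forall l, `|v l| <= V) -> 0 < e ->
  \forall d \near (0 : R), exists w : nat -> 'cV[R]_m,
    trajectory f (s + d) w /\ forall l, `|w l - u l - d *: v l| <= e * `|d|.
Proof.
move=> fs Kc uf uK S0 solve vA V1 vV e0.
set F := fun p : 'cV[R]_m * R => f p.1 p.2 in fs.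
have [dF cdF] := fs 1%N.
have V0 : 0 < V := lt_le_trans ltr01 V1.
have SV0 : 0 < 2 * S * V by rewrite !mulr_gt0.
pose h := Num.min (2 * S)^-1 (e / (2 * S * V)).
have h0 : 0 < h by rewrite lt_min invr_gt0 divr_gt0 ?mulr_gt0.
(* [hS] makes the Newton steps contract, [hSV] bounds their total. *)
have hS : h * S <= 2^-1.
  by rewrite -ler_pdivlMr // -invfM ge_min lexx.
have hSV : 2 * S * (h * V) <= e.
  have : h <= e / (2 * S * V) by rewrite ge_min lexx orbT.
  by rewrite ler_pdivlMr //; apply: le_trans; apply: eq_ler; ring.
have Ksc := compact_slice (s := s) Kc.
have /filter_ex [r [r0 Hr]] : \forall r \near (0 : R)^'+, 0 < r /\
  forall a, (K `*` [set s]) a -> forall p q, `|p - a| < r -> `|q - a| < r ->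
    `|F p - F q - 'd F a (p - q)| <= h * `|p - q|.
  apply: filterI; first exact: nbhs_right_gt.
  exact: uniform_strict_diff.
have strict l (d : R) x y : `|d| < r -> `|x - u l| < r -> `|y - u l| < r ->
    `|f x (s + d) - f y (s + d) - f_u f (u l) s *m (x - y)| <= h * `|x - y|.
  move=> dr xr yr.
  have := Hr (u l, s) (conj (uK l) erefl) (x, s + d) (y, s + d).
  rewrite !pairB [s + d]addrC addrK subrr !prod_normE /= normr0.
  rewrite [Num.max `|x - y| 0]max_l // diff_f_uE ?scale0r ?addr0 //.
  by rewrite [d + s]addrC; apply; rewrite gt_max ?xr ?yr.
have strict0 l (d : R) : V * `|d| < r ->
    `|f (u l + d *: v l) (s + d) - (u l.+1 + d *: v l.+1)| <= h * V * `|d|.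
  move=> dr.
  have dV : `|(d *: v l, d) : 'cV[R]_m * R| <= V * `|d|.
    apply: norm_pair_le; first by rewrite normrZ mulrC ler_wpM2r.
    by rewrite ler_peMl.
  have := Hr (u l, s) (conj (uK l) erefl) (u l + d *: v l, s + d) (u l, s).
  rewrite !pairB [s + d]addrC addrK [u l + _ - _]addrC addKr !subrr /=.
  rewrite diff_f_uE // -scalemxAr -scalerDr -vA uf opprD addrA [d + s]addrC.
  move=> H; apply: le_trans (H _ _) _; first exact: le_lt_trans dV dr.
    by rewrite normr0.
  by rewrite -mulrA ler_wpM2l // ltW.
(* The ball of radius [r] has to contain the parameter increment, the first
   approximation and its corrections. *)
have Ve0 : 0 < 3 * (V + e) by rewrite mulr_gt0 // addr_gt0.
have : \forall d \near (0 : R), `|d| < r / (3 * (V + e)).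
  by apply: nbhs0_lt; rewrite divr_gt0.
apply: filterS => d; rewrite ltr_pdivlMr // => dr.
have dr1 : `|d| < r by apply: le_lt_trans dr; rewrite ler_peMr //; lra.
have dVe : 3 * (V * `|d|) + 3 * (e * `|d|) < r.
  by have -> : 3 * (V * `|d|) + 3 * (e * `|d|) = `|d| * (3 * (V + e)) by ring.
have Vd0 : 0 <= V * `|d| by rewrite mulr_ge0 // ltW.
have ed0 : 0 <= e * `|d| by rewrite mulr_ge0 // ltW.
have hSVd : 2 * S * (h * V * `|d|) <= e * `|d|.
  by rewrite mulrA ler_wpM2r.
have [|||w [wf wd]] := @newton_shadowing R m (f^~ (s + d))
   (fun k => f_u f (u k) s) u (fun l => u l + d *: v l) S h r (h * V * `|d|)
   (ltW S0) (ltW h0) hS solve.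
- by move=> l x y; exact: strict.
- move=> l; rewrite [u l + _ - u l]addrC addKr.
  have : `|d *: v l| <= V * `|d| by rewrite normrZ mulrC ler_wpM2r.
  lra.
- by move=> l; apply: strict0; lra.
exists w; split=> // l; apply: le_trans hSVd.
by have := wd l; rewrite opprD addrA.
Qed.

(** * The derivative of the averages *)

(** Between [(u l, s)] and [(w l, s + d)] the increment is [d] times [(v l, 1)]
    up to a small multiple of [d], and the differential of the objective is
    bounded along [u]. *)
Lemma objective_expansion (R : realType) (m : nat)
  (J : 'cV[R]_m -> R -> R) (s : R) (K : set 'cV[R]_m)
  (u v : nat -> 'cV[R]_m) (V e : R) :
  smooth (fun p : 'cV[R]_m * R => J p.1 p.2) -> compact K ->
  (forall l, K (u l)) -> 1 <= V -> (forall l, `|v l| <= V) -> 0 < e ->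
  exists2 e' : R, 0 < e' & \forall d \near (0 : R), forall w : nat -> 'cV[R]_m,
    (forall l, `|w l - u l - d *: v l| <= e' * `|d|) ->
    forall l, `|J (w l) (s + d) - J (u l) s -
      d * (dot (J_u J (u l) s) (v l) + J_s J (u l) s)| <= e * `|d|.
Proof.
move=> Js Kc uK V1 vV e0; have [M HM] := J_u_bounded s Js Kc.
set F := fun p : 'cV[R]_m * R => J p.1 p.2 in Js.
have [dF cdF] := Js 1%N.
have M0 : 0 <= M := le_trans (normr_ge0 _) (HM _ (uK 0%N)).
have mM0 : 0 <= m%:R * M by rewrite mulr_ge0.
have V10 : 0 < V + 1 by lra.
have mM10 : 0 < 2 * (m%:R * M + 1) by lra.
(* Half of the error is allowed for the distance from [w] to [u + d v], which
   the bound [M] on the gradient amplifies, and half for the nonlinearity. *)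
pose e' := Num.min 1 (e / (2 * (m%:R * M + 1))).
have e'0 : 0 < e' by rewrite lt_min ltr01 divr_gt0.
have e'1 : e' <= 1 by rewrite ge_min lexx.
have e'2 : e' * (2 * (m%:R * M + 1)) <= e.
  by rewrite -ler_pdivlMr // ge_min lexx orbT.
pose h := e / 2 / (V + 1).
have h0 : 0 < h by rewrite !divr_gt0.
have hV : h * (V + 1) = e / 2 by rewrite divfK // gt_eqF.
exists e' => //.
have Ksc := compact_slice (s := s) Kc.
have /filter_ex [r [r0 Hr]] : \forall r \near (0 : R)^'+, 0 < r /\
  forall a, (K `*` [set s]) a -> forall p q, `|p - a| < r -> `|q - a| < r ->
    `|F p - F q - 'd F a (p - q)| <= h * `|p - q|.
  apply: filterI; first exact: nbhs_right_gt.
  exact: uniform_strict_diff_real.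
have : \forall d \near (0 : R), `|d| < r / (V + 1).
  by apply: nbhs0_lt; rewrite divr_gt0.
apply: filterS => d; rewrite ltr_pdivlMr // => dr w wd l.
have wE : w l - u l = d *: v l + (w l - u l - d *: v l).
  by rewrite [RHS]addrC subrK.
have wn : `|w l - u l| <= `|d| * (V + 1).
  rewrite wE mulrDr mulr1; apply: le_trans (ler_normD _ _) _.
  rewrite lerD // ?normrZ ?ler_wpM2l //; apply: le_trans (wd l) _.
  by rewrite ler_piMl.
have pn : `|(w l - u l, d) : 'cV[R]_m * R| <= `|d| * (V + 1).
  apply: norm_pair_le => //; rewrite ler_peMr //; lra.
have := Hr (u l, s) (conj (uK l) erefl) (w l, s + d) (u l, s).
rewrite !pairB [s + d]addrC addrK !subrr /= => H.
have {H} := H (le_lt_trans pn dr); rewrite normr0 => /(_ r0).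
rewrite diff_J_uE // [d + s]addrC => H.
have {}H := le_trans H (ler_wpM2l (ltW h0) pn).
rewrite {1}wE dotDr dotZr in H.
set j := dot _ (w l - u l - d *: v l) in H.
have jn : `|j| <= e / 2 * `|d|.
  apply: le_trans (dot_le _ _) _.
  apply: (@le_trans _ _ (m%:R * M * (e' * `|d|))).
    by rewrite ler_pM ?mulr_ge0 // ler_wpM2l // HM.
  rewrite mulrA ler_wpM2r //; lra.
set a := J (w l) _ in H *; set b := J (u l) s in H *.
set c := dot _ _ in H *; set c' := J_s _ _ _ in H *.
have -> : a - b - d * (c + c') = (a - b - (d * c + j + d * c')) + j by ring.
apply: le_trans (ler_normD _ _) _; apply: le_trans (lerD H jn) _.
by apply: eq_ler; rewrite mulrCA hV; field.
Qed.

(** The difference quotients do not depend on [N], so the estimate makes [A] a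
    Cauchy sequence; the quotients then have the same limit as [A]. *)
Lemma derivable_of_averages (R : realType) (Phi : R -> R) (s : R)
  (A : nat -> R) :
  (forall e : R, 0 < e -> \forall d \near (0 : R)^', \forall N \near \oo,
     `|Phi (s + d) - Phi s - d * A N| <= e * `|d|) ->
  derivable Phi s 1 /\ A @ \oo --> derive1 Phi s.
Proof.
move=> H; pose q d := d^-1 * (Phi (d + s) - Phi s).
have {}H e : 0 < e ->
    \forall d \near (0 : R)^', \forall N \near \oo, `|q d - A N| <= e.
  move=> e0; have := H e e0; rewrite !near_withinE => H1.
  apply: filterS H1 => d Hd d0; have {}Hd := Hd d0.
  apply: filterS Hd => N HN.
  have -> : q d - A N = d^-1 * (Phi (s + d) - Phi s - d * A N).
    by rewrite mulrBr mulKf // /q [d + s]addrC.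
  by rewrite normrM normfV mulrC ler_pdivrMr // normr_gt0.
have [a Aa] : exists a : R, A @ \oo --> a.
  suff /cvg_ex : cvg (A @ \oo) by [].
  apply/cauchy_cvgP/cauchyP => e e0.
  have e2 : 0 < e / 2 by rewrite divr_gt0.
  have /filter_ex [d Hd] := H _ e2; exists (q d).
  apply: filterS Hd => N HN; rewrite -ball_normE /=.
  by apply: le_lt_trans HN _; lra.
have qa : q d @[d --> (0 : R)^'] --> a.
  apply/cvgrPdist_le => e e0; have e2 : 0 < e / 2 by rewrite divr_gt0.
  apply: filterS (H _ e2) => d Hd.
  have /cvgrPdist_le /(_ _ e2) Ha := Aa.
  have [N [H1 H2]] := filter_ex (filterI Ha Hd).
  rewrite -(subrKA (A N)) [e]splitr; apply: le_trans (ler_normD _ _) _.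
  by rewrite lerD // distrC.
split.
  apply/cvg_ex; exists a; rewrite /= in qa *.
  have -> // : (fun h : R => h^-1 *: ((Phi \o shift s) (h *: 1) - Phi s)) = q.
  by apply/funext => h; rewrite /= /q -[h *: 1]/(h * 1) mulr1.
by rewrite /derive1 (cvg_lim _ qa).
Qed.

(** * The adjoint equation *)

(** The adjoint recursion determines a value from the next one, so solving it
    forward in time applies [A l], there the inverse of a transposed
    derivative, to the forcing as well. Shifting the unknown by the forcing
    gives a bound that is independent of the size of [A l]. *)
Lemma dichotomy_shifted_solution (R : realType) (m : nat)
  (A Q : nat -> 'M[R]_m) (C t H : R) (h : nat -> 'cV[R]_m) :
  dichotomy A Q C t -> (forall l, `|h l| <= H) ->
  exists x : nat -> 'cV[R]_m, exists M : R,
  [/\ Q 0%N *m x 0%N = 0, forall l, x l.+1 = A l *m (x l + h l) &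
      forall l, `|x l| <= M].
Proof.
move=> D hH; have [C0 t0 t1 D'] := D.
have [y [y0 yA yM]] := dichotomy_bounded_solution D (fun l => hH l.+1).
have QQ : Q 0%N *m Q 0%N = Q 0%N by have [] := D' 0%N.
pose z l := transition A 0 l *m Q 0%N *m h 0%N.
have H0 : 0 <= H := le_trans (normr_ge0 _) (hH 0%N).
have zM l : `|z l| <= m%:R * C * H.
  apply: le_trans (normmx_mul _ _) _; rewrite ler_pM ?mulr_ge0 //.
  rewrite ler_wpM2l //; have [_ _ _ /(_ l) + _] := D' 0%N.
  by move=> /le_trans; apply; rewrite ler_piMr // exprn_ile1 // ltW.
have zA l : z l.+1 = A l *m z l by rewrite /z /= add0n !mulmxA.
(* With [x + h] as the unknown the forcing becomes [h] one step later; the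
   decaying solution [z] of the homogeneous recursion restores the initial
   condition for [x]. *)
exists (fun l => y l + z l - h l).
exists (2 * (m%:R * C / (1 - t)) * H + m%:R * C * H + H); split=> [|l|l].
- by rewrite mulmxBr mulmxDr y0 add0r /z /= mul1mx mulmxA QQ subrr.
- by rewrite subrK yA zA mulmxDr addrAC addrK.
apply: le_trans (ler_normB _ _) _; rewrite lerD //.
by apply: le_trans (ler_normD _ _) _; rewrite lerD.
Qed.

Lemma bounded_enorm (R : realType) (m : nat) (x : nat -> 'cV[R]_m) (M : R) :
  (forall l, `|x l| <= M) -> exists M' : R, forall l, enorm (x l) <= M'.
Proof.
move=> xM; exists (m%:R * M) => l.
by apply: le_trans (enorm_le_norm _) _; rewrite ler_wpM2l.
Qed.

Lemma adjoint_shadowing_unique (R : realType) (m : nat)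
  (f : 'cV[R]_m -> R -> 'cV[R]_m) (J : 'cV[R]_m -> R -> R) (s : R)
  (Vp Vm : 'cV[R]_m -> {vspace 'cV[R]_m}) (u : nat -> 'cV[R]_m) (C t H : R) :
  dichotomy (fun k => f_u f (u k) s)
    (fun k => 1%:M - proj_matrix (Vp (u k)) (Vm (u k))) C t ->
  (forall l, `|J_u J (u l) s| <= H) ->
  exists vbar, unique (adjoint_shadowing f J s Vp Vm u) vbar.
Proof.
move=> D JH; have D' := dichotomy_adjoint D; have [_ _ _ D0] := D.
set A := fun k => f_u f (u k) s in D D' D0.
have ATu k : (f_u f (u k) s)^T \in unitmx by rewrite unitmx_tr; have [] := D0 k.
have QE k : (1%:M - (1%:M - proj_matrix (Vp (u k)) (Vm (u k))))^T =
            (proj_matrix (Vp (u k)) (Vm (u k)))^T.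
  by rewrite opprB addrC subrK.
have NJH l : `|- J_u J (u l) s| <= H by rewrite normrN.
have [x [M [x0 xA xM]]] := dichotomy_shifted_solution D' NJH.
exists x; split; first split.
- by move=> l; rewrite xA mulKVmx // subrK.
- by rewrite -QE.
- exact: bounded_enorm xM.
move=> y [yA y0 [N yN]]; apply/funext => l; apply/eqP; rewrite -subr_eq0.
apply/eqP; apply: (dichotomy_bounded_unique (x := fun l => x l - y l)
  (M := M + N) D').
- by rewrite mulmxBr x0 QE y0 subrr.
- move=> k; rewrite mulmxBr; apply: (can_inj (mulKmx (ATu k))).
  rewrite mulmxBr mulmxBr !mulKVmx // xA mulKVmx // [y k]yA.
  by rewrite opprD addrA addrAC.
move=> k; apply: le_trans (ler_normB _ _) _; rewrite lerD //.
by apply: le_trans (norm_le_enorm _) _.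
Qed.

(** Pairing the tangent solution with the adjoint one telescopes, so the two
    forms of the sensitivity have averages that differ by a boundary term. *)
Lemma adjoint_tangent_telescope (R : realType) (m : nat)
  (A : nat -> 'M[R]_m) (g h v y : nat -> 'cV[R]_m) (N : nat) :
  (forall l, v l.+1 = A l *m v l + g l) ->
  (forall l, y l = (A l)^T *m y l.+1 + h l) ->
  \sum_(l < N) dot (y l.+1) (g l) =
  \sum_(l < N) dot (h l) (v l) + (dot (y N) (v N) - dot (y 0%N) (v 0%N)).
Proof.
move=> vA yA; elim: N => [|N IH]; first by rewrite !big_ord0 subrr addr0.
rewrite !big_ord_recr /= IH vA dotDr dot_mulmx.
by rewrite {1}(yA N) dotDl; ring.
Qed.

Theorem theorem2p4 (R : realType) (m : nat)
  (f : 'cV[R]_m -> R -> 'cV[R]_m) (J : 'cV[R]_m -> R -> R)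
  (f_smooth : smooth (fun p : 'cV[R]_m * R => f p.1 p.2))
  (J_smooth : smooth (fun p : 'cV[R]_m * R => J p.1 p.2))
  (f_diffeo : forall s : R, diffeomorphism (fun u : 'cV[R]_m => f u s))
  (Javg : R -> R) (JavgP : is_Javg f J Javg)
  (s : R) (K : set 'cV[R]_m) (K_attr : global_compact_attractor f s K)
  (Vp Vm : 'cV[R]_m -> {vspace 'cV[R]_m})
  (hyp : hyperbolic_splitting f s K Vp Vm)
  (u : nat -> 'cV[R]_m) (u_traj : trajectory f s u) (u_K : forall l, K (u l)) :
  exists vbar : nat -> 'cV[R]_m,
    unique (adjoint_shadowing f J s Vp Vm u) vbar /\
    derivable Javg s 1 /\
    (fun N : nat => (N%:R)^-1 *
       \sum_(l < N) (dot (vbar l.+1) (f_s f (u l) s) + J_s J (u l) s)) @ \oo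
      --> derive1 Javg s.
Proof.
have [Kc _ _] := K_attr.
have [C [t D]] := hyperbolic_dichotomy f_smooth Kc (f_diffeo s) hyp u_traj u_K.
have [HJ JH] := J_u_bounded s J_smooth Kc.
have [Hf fH] := f_s_bounded s f_smooth Kc.
have [vbar vbarP] := adjoint_shadowing_unique D (fun l => JH _ (u_K l)).
exists vbar; split=> //; have [[vbarA _ [M vbarM]] _] := vbarP.
have [v [_ vA vV]] := dichotomy_bounded_solution D (fun l => fH _ (u_K l)).
set V0 := 2 * _ * Hf in vV; pose V := V0 + 1.
have V00 : 0 <= V0 := le_trans (normr_ge0 _) (vV 0%N).
have V1 : 1 <= V by rewrite /V lerDr.
have {}vV l : `|v l| <= V by rewrite (le_trans (vV l)) // lerDl.
have [C0 _ t1 _] := D.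
pose S := 2 * (m%:R * C / (1 - t)) + 1.
have S0 : 0 < S.
  by rewrite ltr_wpDl // !mulr_ge0 // invr_ge0 subr_ge0 ltW.
have solve g G : (forall l, `|g l| <= G) -> exists x : nat -> 'cV[R]_m,
    (forall l, x l.+1 = f_u f (u l) s *m x l + g l) /\
    (forall l, `|x l| <= S * G).
  move=> gG; have [x [_ xA xG]] := dichotomy_bounded_solution D gG.
  exists x; split=> // l; apply: le_trans (xG l) _.
  by rewrite ler_wpM2r ?(le_trans _ (gG 0%N)) // lerDl.
pose a l := dot (J_u J (u l) s) (v l) + J_s J (u l) s.
pose A N := N%:R^-1 * \sum_(l < N) a l.
have [Jder AJ] : derivable Javg s 1 /\ A @ \oo --> derive1 Javg s.
  apply: derivable_of_averages => e e0.
  have e2 : 0 < e / 2 by rewrite divr_gt0.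
  have [e' e'0 exp] := objective_expansion s J_smooth Kc u_K V1 vV e2.
  have shad := shadowing_orbits f_smooth Kc u_traj u_K S0 solve vA V1 vV e'0.
  rewrite near_withinE; apply: filterS (filterI exp shad).
  move=> d [expd [w [wf wd]]] d0.
  have {expd}exp_l := expd w wd.
  have d0' : 0 < e / 2 * `|d| by rewrite mulr_gt0 // normr_gt0.
  (* Every orbit of the perturbed map computes the perturbed average, in
     particular the one that shadows [u]. *)
  have lim1 : (N%:R^-1 * \sum_(i < N) J (w i) (s + d) -
               N%:R^-1 * \sum_(i < N) J (u i) s) @[N --> \oo] -->
              Javg (s + d) - Javg s.
    by apply: cvgB; [exact: JavgP wf | exact: JavgP u_traj].
  have /cvgrPdist_le /(_ _ d0') := lim1; apply: filterS => N /= HN.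
  set X := N%:R^-1 * \sum_(i < N) J (w i) _ in HN.
  set Y := N%:R^-1 * \sum_(i < N) J (u i) _ in HN.
  have avg : `|X - Y - d * A N| <= e / 2 * `|d|.
    have -> : X - Y - d * A N = N%:R^-1 *
        \sum_(i < N) (J (w i) (s + d) - J (u i) s - d * a i).
      by rewrite !sumrB -mulr_sumr /X /Y /A; ring.
    rewrite normrM ger0_norm ?invr_ge0 //.
    apply: (@le_trans _ _ (N%:R^-1 * (N%:R * (e / 2 * `|d|)))).
      rewrite ler_wpM2l ?invr_ge0 //; apply: le_trans (ler_norm_sum _ _ _) _.
      rewrite -[N in N%:R * _]card_ord mulr_natl -sumr_const.
      by apply: ler_sum => i _; exact: exp_l.
    rewrite (mulrA N%:R^-1); case: (N) => [|k].
      by rewrite mulr0n mulr0 mul0r ltW.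
    by rewrite mulVf ?mul1r // pnatr_eq0.
  have -> : Javg (s + d) - Javg s - d * A N =
    (Javg (s + d) - Javg s - (X - Y)) + (X - Y - d * A N) by ring.
  apply: le_trans (ler_normD _ _) _; apply: le_trans (lerD HN avg) _.
  by rewrite -mulrDl -splitr.
split; first exact: Jder.
pose b N := dot (vbar N) (v N).
have bB N : `|b N| <= m%:R * M * V.
  apply: le_trans (dot_le _ _) _.
  rewrite -!mulrA ler_wpM2l // ler_pM //.
  by apply: le_trans (norm_le_enorm _) _.
have E : (fun N : nat => N%:R^-1 *
    \sum_(l < N) (dot (vbar l.+1) (f_s f (u l) s) + J_s J (u l) s)) =
  (fun N => A N + N%:R^-1 * (b N - b 0%N)).
  apply/funext => N; rewrite big_split /=.
  rewrite (adjoint_tangent_telescope N vA vbarA) /A [in RHS]big_split /=.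
  by rewrite /b; ring.
rewrite E -[X in _ --> X]addr0; apply: cvgD => //.
apply/cvgrPdist_le => e e0.
have B0 : 0 <= m%:R * M * V := le_trans (normr_ge0 _) (bB 0%N).
near=> N.
have N0 : 0 < N%:R :> R by near: N; exact: nbhs_infty_gtr.
rewrite sub0r normrN normrM ger0_norm ?invr_ge0 // mulrC ler_pdivrMr //.
apply: (@le_trans _ _ (2 * (m%:R * M * V))).
  apply: le_trans (ler_normB _ _) _.
  by apply: le_trans (lerD (bB _) (bB _)) _; rewrite mulr2n mulrDl mul1r.
rewrite [leRHS]mulrC -ler_pdivrMr //; apply: ltW.
by near: N; exact: nbhs_infty_gtr.
Unshelve. all: by end_near. Qed.
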